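(* Let $n$ and $m$ be positive odd integers and $a>0$. Then \[ \int_{-a}^{1}\frac{\sin\bigl(n\sin^{-1}\sqrt t\bigr)\sinh\bigl(m\sinh^{-1}\sqrt{t/a}\bigr)}{\rho_a(t)}\,\frac{t^j\,dt}{\sqrt{(1-t)(1+t/a)}}=\begin{cases}\pi/2,& j=-1,\\ 0,& j=0,1,\ldots,\frac{m+n-2}{2},\end{cases} \] and \[ \int_{-a}^{1}\frac{\cos\bigl(n\sin^{-1}\sqrt t\bigr)\cosh\bigl(m\sinh^{-1}\sqrt{t/a}\bigr)}{\rho_a(t)}\,t^j\,dt=0,\qquad j=0,1,\ldots,\tfrac{m+n-4}{2}. \]
   Context: $\rho_a(t)=\cos\bigl(2n\sin^{-1}\sqrt t\bigr)+\cosh\bigl(2m\sinh^{-1}\sqrt{t/a}\bigr)=T_n(1-2t)+T_m(1+2t/a)$ for $t\in[-a,1]$, where $T_k(\cos\theta)=\cos k\theta$ is the Chebyshev polynomial of the first kind; it is positive on $[-a,1]$. Convention for negative arguments: for $t<0$, $\sqrt t:=i\sqrt{-t}$, $\sin^{-1}(iy):=i\sinh^{-1}y$ ($y\ge0$), $\sinh^{-1}(iy):=i\sin^{-1}y$ ($0\le y\le1$); with this convention all integrands are real. *)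

(* Defs.v *)
From HB Require Import structures.
From mathcomp Require Import all_boot all_order all_algebra.
From mathcomp Require Import all_classical all_reals all_analysis.
Set Implicit Arguments. Unset Strict Implicit. Unset Printing Implicit Defensive.
Import Order.TTheory GRing.Theory Num.Theory.
Local Open Scope ring_scope.

Section Hyp.
Variable R : realType.

Definition sinhR (x : R) : R := (expR x - expR (- x)) / 2.
Definition coshR (x : R) : R := (expR x + expR (- x)) / 2.
Definition asinhR (x : R) : R := ln (x + Num.sqrt (x ^+ 2 + 1)).

(* Convention of the paper for t < 0:  sqrt t = i sqrt(-t),
   asin (i y) = i asinh y,  asinh (i y) = i asin y; hence
   sin(n asin sqrt t) sinh(m asinh sqrt(t/a))
     = - sinh(n asinh sqrt(-t)) sin(m asin sqrt(-t/a)),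
   cos(n asin sqrt t) = cosh(n asinh sqrt(-t)),
   cosh(m asinh sqrt(t/a)) = cos(m asin sqrt(-t/a)). *)

Definition SS (n m : nat) (a t : R) : R :=
  if 0 <= t then
    sin (n%:R * asin (Num.sqrt t)) * sinhR (m%:R * asinhR (Num.sqrt (t / a)))
  else
    - (sinhR (n%:R * asinhR (Num.sqrt (- t))) * sin (m%:R * asin (Num.sqrt (- t / a)))).

Definition CC (n m : nat) (a t : R) : R :=
  if 0 <= t then
    cos (n%:R * asin (Num.sqrt t)) * coshR (m%:R * asinhR (Num.sqrt (t / a)))
  else
    coshR (n%:R * asinhR (Num.sqrt (- t))) * cos (m%:R * asin (Num.sqrt (- t / a))).

Definition rho (n m : nat) (a t : R) : R :=
  if 0 <= t then
    cos ((2 * n)%:R * asin (Num.sqrt t)) + coshR ((2 * m)%:R * asinhR (Num.sqrt (t / a)))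
  else
    coshR ((2 * n)%:R * asinhR (Num.sqrt (- t))) + cos ((2 * m)%:R * asin (Num.sqrt (- t / a))).

Definition integrand1 (n m : nat) (a : R) (j : int) (t : R) : R :=
  SS n m a t / rho n m a t * (t ^ j / Num.sqrt ((1 - t) * (1 + t / a))).

Definition integrand2 (n m : nat) (a : R) (j : nat) (t : R) : R :=
  CC n m a t / rho n m a t * t ^+ j.

End Hyp.

(* Main.v *)
Require Import Defs.
From HB Require Import structures.
From mathcomp Require Import all_boot all_order all_algebra.
From mathcomp Require Import all_classical all_reals all_analysis.
From mathcomp Require Import measurable_realfun complex ring lra zify.
Import Order.TTheory GRing.Theory Num.Theory.
Import numFieldNormedType.Exports Normc.
Local Open Scope ring_scope.
Local Open Scope classical_set_scope.

(** For [n = 2k+1] and [m = 2l+1] the functions [SS], [CC / w] and [rho], where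
    [w t = sqrt ((1 - t) (1 + t / a))], are polynomials in [t], and
    [rho = 2 (CC ^ 2 + SS ^ 2)].  Put [t = (1 - a) / 2 + (1 + a) / 2 * cos al] and
    [u = exp (i al)].  Then [CC + i SS = i Q(u) / u ^ (k + l + 1)] for a real
    polynomial [Q], so each integrand, multiplied by [w], is the real part of [N(u) / Q(u)]
    for a real polynomial [N].  [Q] has no zero in the closed unit disc, because
    [CC + i SS] is the cosine of [n theta - i m phi], where the moduli of
    [exp (i theta)] and [exp phi] lie on the same side of 1.  The mean value
    property then gives the integral as [sqrt a * pi * N(0) / Q(0)].

    To obtain the mean value property without complex integration, [N / Q] is
    approximated uniformly on the disc by polynomials (geometric series at each zero of
    [Q]); this reduces everything to the integrals of [cos (k al) / w]. *)

(** * Uniform polynomial approximation of rational functions on the unit disc *)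

Section DiscApproximation.
Local Open Scope complex_scope.
Variable R : realType.
Local Notation C := R[i].
Local Notation Re := (@complex.Re R).
Local Notation Im := (@complex.Im R).

Definition disc_approx (g : C -> C) := forall e : R, 0 < e ->
  exists P : {poly C}, forall u, normc u <= 1 -> normc (g u - P.[u]) <= e.

Lemma normc_ge0 (z : C) : 0 <= normc z.
Proof. by case: z => x y; rewrite sqrtr_ge0. Qed.

Lemma normcB (x y : C) : normc (x - y) = normc (y - x).
Proof. by rewrite -(normcN (x - y)) opprB. Qed.

Lemma normcX (z : C) k : normc (z ^+ k) = normc z ^+ k.
Proof.
elim: k => [|k IH]; first by rewrite !expr0 [LHS]normc1.
by rewrite !exprS normcM IH.
Qed.

Lemma poly_disc_bounded (P : {poly C}) :
  exists2 B : R, 0 <= B & forall u, normc u <= 1 -> normc P.[u] <= B.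
Proof.
elim/poly_ind: P => [|P c [B B0 HB]].
  by exists 0 => // u _; rewrite horner0 [normc _]normc0.
exists (B + normc c); first by rewrite addr_ge0 ?normc_ge0.
move=> u hu; rewrite hornerMXaddC; apply: le_trans (le_normcD _ _) _.
rewrite lerD2r normcM -[B]mulr1; apply: ler_pM => //; try exact: normc_ge0.
exact: HB.
Qed.

Lemma disc_approx_poly (P : {poly C}) : disc_approx (fun u => P.[u]).
Proof.
by move=> e e0; exists P => u _; rewrite subrr [normc _]normc0 ltW.
Qed.

(** An approximable function is bounded on the disc, being within 1 of a polynomial, so the usual
    estimate for products applies. *)
Lemma disc_approxM f g : disc_approx f -> disc_approx g ->
  disc_approx (fun u => f u * g u).
Proof.
move=> hf hg e e0.
have [P0 hP0] := hg 1 ltr01.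
have [B B0 hB] := poly_disc_bounded P0.
have B2 : 0 < B + 1 by rewrite ltr_wpDl.
(* The order matters: the tolerance for [F] depends on the bound of [g], and the tolerance for [G]
   on the bound of the chosen [F]. *)
have [F hF] := hf (e / 2 / (B + 1)) ltac:(by rewrite !divr_gt0).
have [B' B'0 hB'] := poly_disc_bounded F.
have B'2 : 0 < B' + 1 by rewrite ltr_wpDl.
have [G hG] := hg (e / 2 / (B' + 1)) ltac:(by rewrite !divr_gt0).
exists (F * G) => u hu; rewrite hornerM.
have -> : f u * g u - F.[u] * G.[u] = (f u - F.[u]) * g u + F.[u] * (g u - G.[u])
  by ring.
apply: le_trans (le_normcD _ _) _; rewrite !normcM.
have gB : normc (g u) <= B + 1.
  rewrite -(subrK P0.[u] (g u)) addrC; apply: le_trans (le_normcD _ _) _.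
  by apply: lerD; [exact: hB|exact: hP0].
have h1 : normc (f u - F.[u]) * normc (g u) <= e / 2.
  rewrite -[leRHS](divfK (lt0r_neq0 B2)).
  by apply: ler_pM gB; rewrite ?normc_ge0 ?hF.
have h2 : normc F.[u] * normc (g u - G.[u]) <= e / 2.
  rewrite -[leRHS](divfK (lt0r_neq0 B'2)) mulrC.
  apply: ler_pM; rewrite ?normc_ge0 ?hG//.
  by apply: le_trans (hB' _ hu) _; rewrite lerDl.
lra.
Qed.

(* Geometric series of [(u - v)^-1] around [u = 0]. *)
Lemma disc_approx_inv_linear (v : C) : 1 < normc v ->
  disc_approx (fun u => (u - v)^-1).
Proof.
move=> hv e e0.
have v0 : v != 0 by apply: contraTneq hv => ->; rewrite [normc _]normc0 ltr10.
have hr : `|(normc v)^-1| < 1.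
  by rewrite ger0_norm ?invr_ge0 ?normc_ge0// invf_lt1// (lt_trans ltr01).
have d0 : 0 < normc v - 1 by rewrite subr_gt0.
(* The remainder after [K] terms is [(u / v) ^+ K / (u - v)], and [normc (u - v) >= normc v - 1] on
   the disc; hence this threshold for the power of [(normc v)^-1]. *)
have := @cvg_expr R _ hr => /cvgrPdist_lt/(_ (e * (normc v - 1))) /(_ (mulr_gt0 e0 d0)).
case=> K _ /(_ K (leqnn K)); rewrite sub0r normrN => hK.
exists (- \sum_(k < K) (v^-1 ^+ k.+1) *: 'X^k) => u hu.
have uv : u - v != 0.
  rewrite subr_eq0; apply: contraTneq hu => ->; by rewrite -ltNge.
have ES : (u - v) * \sum_(k < K) v^-1 ^+ k.+1 * u ^+ k = (u / v) ^+ K - 1.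
  elim: (K) => [|k IH]; first by rewrite big_ord0 mulr0 expr0 subrr.
  rewrite big_ord_recr /= mulrDr IH !exprMn !exprS.
  by field.
have -> : (u - v)^-1 - (- \sum_(k < K) v^-1 ^+ k.+1 *: 'X^k).[u]
  = (u / v) ^+ K / (u - v).
  rewrite hornerN horner_sum opprK.
  under eq_bigr do rewrite hornerZ hornerXn.
  by apply: (mulfI uv); rewrite mulrDr ES; field.
rewrite normcM normcV normcX normcM normcV.
have duv : normc v - 1 <= normc (u - v).
  rewrite lerBlDr normcB -{1}(subrK u v).
  by apply: le_trans (le_normcD _ _) _; rewrite lerD2l.
rewrite ler_pdivrMr ?(lt_le_trans d0)//.
apply: (@le_trans _ _ (e * (normc v - 1))); last by rewrite ler_pM2l.
apply: le_trans (ltW hK); rewrite normrX ger0_norm ?invr_ge0 ?normc_ge0//.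
apply: lerXn2r; rewrite ?nnegrE ?mulr_ge0 ?invr_ge0 ?normc_ge0//.
by rewrite ler_piMl// invr_ge0 normc_ge0.
Qed.

(** [Q] splits over [C], and every root lies outside the closed disc, so the inverse is a product of
    approximable inverses of linear factors. *)
Lemma disc_approx_inv_poly (Q : {poly C}) :
  (forall u, normc u <= 1 -> Q.[u] != 0) -> disc_approx (fun u => (Q.[u])^-1).
Proof.
have [r ->] := closed_field_poly_normal Q; move: (lead_coef Q) => c.
elim: r => [|v r IH] hQ.
  rewrite big_nil; have -> : (fun u => (c *: 1).[u]^-1) = (fun u => (c^-1)%:P.[u]).
    by apply/funext => u; rewrite !hornerE.
  exact: disc_approx_poly.
have E u : (c *: \prod_(z <- v :: r) ('X - z%:P)).[u]
   = (u - v) * (c *: \prod_(z <- r) ('X - z%:P)).[u].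
  by rewrite big_cons scalerAr hornerM hornerXsubC.
have -> : (fun u => (c *: \prod_(z <- v :: r) ('X - z%:P)).[u]^-1)
  = (fun u => (u - v)^-1 * (c *: \prod_(z <- r) ('X - z%:P)).[u]^-1).
  by apply/funext => u; rewrite E invfM.
apply: disc_approxM.
  apply: disc_approx_inv_linear; rewrite ltNge; apply/negP => /hQ.
  by rewrite E subrr mul0r eqxx.
by apply: IH => u /hQ; rewrite E mulf_eq0 negb_or => /andP[].
Qed.

Definition circ (al : R) : C := cos al +i* sin al.

Lemma circX al k : circ al ^+ k = circ (k%:R * al).
Proof.
elim: k => [|k IH]; first by rewrite mul0r /circ cos0 sin0.
rewrite exprS IH /circ -addn1 natrD mulrDl mul1r cosD sinD.
by apply/eqP; rewrite eq_complex /=; apply/andP; split; apply/eqP; ring.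
Qed.

Lemma normc_circ al : normc (circ al) = 1.
Proof. by rewrite /= cos2Dsin2 sqrtr1. Qed.

Lemma ReD (x y : C) : Re (x + y) = Re x + Re y.
Proof. by move: x y => [a b] [c d]. Qed.

Lemma ReN (x : C) : Re (- x) = - Re x.
Proof. by case: x. Qed.

Lemma Re_sum (I : Type) (r : seq I) (F : I -> C) :
  Re (\sum_(i <- r) F i) = \sum_(i <- r) Re (F i).
Proof. by elim: r => [|i r IH]; rewrite ?big_nil// !big_cons ReD IH. Qed.

Lemma Re_le_normc (z : C) : `|Re z| <= normc z.
Proof.
by case: z => x y /=; rewrite -sqrtr_sqr ler_wsqrtr// lerDl sqr_ge0.
Qed.

Lemma Re_conjc (z : C) : Re (conjc z) = Re z.
Proof. by case: z. Qed.

Lemma horner_real_conjc (P : {poly R}) (u : C) :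
  (map_poly (real_complex R) P).[conjc u] = conjc (map_poly (real_complex R) P).[u].
Proof.
rewrite -horner_map -map_poly_comp; congr (_.[_]).
by apply: eq_map_poly => x /=; rewrite oppr0.
Qed.

Lemma circN al : circ (- al) = conjc (circ al).
Proof. by rewrite /circ cosN sinN. Qed.

(* As [N] and [Q] have real coefficients, the real part is even in [al]; hence
   averaging over [al] and [- al] removes the sine terms. *)
Lemma Re_ratio_approx_cos (N Q : {poly R}) :
  (forall u, normc u <= 1 -> (map_poly (real_complex R) Q).[u] != 0) ->
  forall e : R, 0 < e -> exists2 A : {poly R},
    forall al, `|Re ((map_poly (real_complex R) N).[circ al]
                     / (map_poly (real_complex R) Q).[circ al])
               - \sum_(k < size A) A`_k * cos (k%:R * al)| <= e
  & `|N.[0] / Q.[0] - A`_0| <= e.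
Proof.
move=> hQ e e0.
have [P hP] := disc_approxM _ _ (disc_approx_poly (map_poly (real_complex R) N))
  (disc_approx_inv_poly _ hQ) e e0.
(* Only the real parts of the coefficients of [P] survive the averaging. The bound on the constant
   term is the approximation at the centre [u = 0]. *)
exists (\poly_(k < size P) Re P`_k); last first.
  have := hP 0; rewrite [normc 0]normc0 => /(_ ler01); apply: le_trans.
  apply: le_trans (Re_le_normc _); rewrite -(rmorph0 (real_complex R)).
  rewrite !horner_map -fmorphV -rmorphM /= ReD ReN /= coef_poly.
  by rewrite (horner_coef0 P); case: ltnP => // h; rewrite nth_default.
move=> al.
set A := \poly_(k < _) _; set h := Re _.
have -> : \sum_(k < size A) A`_k * cos (k%:R * al) =
    \sum_(k < size P) Re P`_k * cos (k%:R * al).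
  (* [A] may be shorter than [P], because real parts of top coefficients can vanish; the extra terms
     are zero. *)
  rewrite (big_ord_widen (size P) (fun k => A`_k * cos (k%:R * al)))
    ?size_poly// big_mkcond.
  apply: eq_bigr => k _; case: ltnP => [_|hk]; first by rewrite coef_poly ltn_ord.
  move: hk => /(nth_default 0); rewrite coef_poly ltn_ord => ->; by rewrite mul0r.
have key b : Re P.[circ b] = \sum_(k < size P) Re P`_k * cos (k%:R * b)
             - \sum_(k < size P) Im P`_k * sin (k%:R * b).
  rewrite horner_coef Re_sum -sumrB; apply: eq_bigr => k _.
  by rewrite circX /circ; case: (P`_k).
have h1 : `|h - Re P.[circ al]| <= e.
  rewrite -ReN -ReD; apply: le_trans (Re_le_normc _) _; apply: hP.
  by rewrite normc_circ.
have h2 : `|h - Re P.[circ (- al)]| <= e.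
  have -> : h = Re ((map_poly (real_complex R) N).[circ (- al)] *
                    ((map_poly (real_complex R) Q).[circ (- al)])^-1).
    by rewrite circN !horner_real_conjc -fmorphV -rmorphM /= Re_conjc.
  rewrite -ReN -ReD; apply: le_trans (Re_le_normc _) _; apply: hP.
  by rewrite normc_circ.
have E2 : \sum_(k < size P) Im P`_k * sin (k%:R * - al) =
   - \sum_(k < size P) Im P`_k * sin (k%:R * al).
  by rewrite -sumrN; apply: eq_bigr => k _; rewrite mulrN sinN mulrN.
have E1 : \sum_(k < size P) Re P`_k * cos (k%:R * - al) =
   \sum_(k < size P) Re P`_k * cos (k%:R * al).
  by apply: eq_bigr => k _; rewrite mulrN cosN.
move: h1 h2; rewrite !key E1 E2 !ler_norml => /andP[? ?] /andP[? ?].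
by apply/andP; split; lra.
Qed.

End DiscApproximation.

(** * Chebyshev recurrences for odd multiples, and non-vanishing *)

Section OddChebyshev.
Local Open Scope complex_scope.
Variable A : comNzRingType.
Implicit Types x y : A.

(* For [y = 1] and [x = sin th ^ 2] the recurrence is that of
   [cos ((2k+1) th) / cos th] and [sin ((2k+1) th) / sin th]; for [x = - sinh ph ^ 2] it is
   the hyperbolic one.  The variable [y] makes [chc k] and [chs k] homogeneous of
   degree [k]. *)
Definition chstep x y (p : A * A) : A * A :=
  ((y - 2 * x) * p.1 - 2 * x * p.2, (y - 2 * x) * p.2 + 2 * (y - x) * p.1).

Definition chc k x y : A := (iter k (chstep x y) (1, 1)).1.
Definition chs k x y : A := (iter k (chstep x y) (1, 1)).2.

Lemma chcS k x y : chc k.+1 x y = (y - 2 * x) * chc k x y - 2 * x * chs k x y.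
Proof. by []. Qed.

Lemma chsS k x y : chs k.+1 x y = (y - 2 * x) * chs k x y + 2 * (y - x) * chc k x y.
Proof. by []. Qed.

Lemma ch_scale c k x y :
  chc k (c * x) (c * y) = c ^+ k * chc k x y /\
  chs k (c * x) (c * y) = c ^+ k * chs k x y.
Proof.
elim: k => [|k [IHc IHs]]; first by rewrite !expr0 !mul1r.
by rewrite !chcS !chsS IHc IHs !exprS; split; ring.
Qed.

(** Serves to evaluate [Qp] at [u = 0]: since [chc] and [chs] agree there, the two summands of [Qp]
    are equal and cannot cancel. *)
Lemma ch_at0 k x : chc k x 0 = (- 4 * x) ^+ k /\ chs k x 0 = (- 4 * x) ^+ k.
Proof.
elim: k => [|k [IHc IHs]]; first by rewrite !expr0.
by rewrite !chcS !chsS IHc IHs !exprS; split; ring.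
Qed.

(** Gives the value at [x = 0], and later the divisibility by [Tp] that removes the pole [1 / t] in
    the case [j = -1]. *)
Lemma chc_modx k x y : exists r, chc k x y = y ^+ k + x * r.
Proof.
elim: k => [|k [r IH]]; first by exists 0; rewrite expr0 mulr0 addr0.
exists (y * r - 2 * (y ^+ k + x * r) - 2 * chs k x y).
by rewrite chcS IH exprS; ring.
Qed.

(* De Moivre: with [X = cos th], [Z = i sin th] or [X = cosh th], [Z = sinh th]. *)
Lemma ch_pow k x X Z : X ^+ 2 = 1 - x -> Z ^+ 2 = - x ->
  (X + Z) ^+ k.*2.+1 = X * chc k x 1 + Z * chs k x 1.
Proof.
move=> hX hZ; elim: k => [|k IH]; first by rewrite expr1 !mulr1.
rewrite doubleS 2!exprS IH chcS chsS.
transitivity ((X ^+ 2 + Z ^+ 2 + 2 * X * Z) * (X * chc k x 1 + Z * chs k x 1)).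
  by ring.
transitivity (X * ((X ^+ 2 + Z ^+ 2) * chc k x 1 + 2 * Z ^+ 2 * chs k x 1)
  + Z * ((X ^+ 2 + Z ^+ 2) * chs k x 1 + 2 * X ^+ 2 * chc k x 1)); first by ring.
by rewrite hX hZ; ring.
Qed.

End OddChebyshev.
Arguments chc {A}.
Arguments chs {A}.
Arguments chc_modx {A}.

Lemma ch_rmorph (A B : comNzRingType) (f : {rmorphism A -> B}) k x y :
  f (chc k x y) = chc k (f x) (f y) /\ f (chs k x y) = chs k (f x) (f y).
Proof.
elim: k => [|k [IHc IHs]]; first by split; exact: rmorph1.
by rewrite !chcS !chsS !(rmorph_nat, rmorphD, rmorphN, rmorphM) IHc IHs ?rmorph1.
Qed.

(** * Zeros of the complex cosine [cos (n theta - i m phi)] *)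

Section NonVanishing.
Local Open Scope complex_scope.
Variable R : realType.
Local Notation C := R[i].
Local Notation Re := (@complex.Re R).
Local Notation Im := (@complex.Im R).

(** If [B2 < 0], the first and third relations give [A1 ^+ 2 <= a * B1 ^+ 2], and then the second
    gives [A2 ^+ 2 + a + 1 <= a * B2 ^+ 2]. Multiplying contradicts the square of
    [A1 * A2 = a * (B1 * B2)]. *)
Lemma halfplane_core (a A1 A2 B1 B2 : R) : 0 < a ->
  A1 * A2 = a * (B1 * B2) ->
  A1 ^+ 2 - A2 ^+ 2 - 1 = a * (B1 ^+ 2 - B2 ^+ 2 + 1) ->
  A2 * B1 <= A1 * B2 -> 0 < A1 -> 0 <= B2.
Proof.
move=> a0 hI hR hAB hA1; rewrite leNgt; apply/negP => hB2.
have h1 : B2 * (a * B1 ^+ 2 - A1 ^+ 2) <= 0.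
  have -> : B2 * (a * B1 ^+ 2 - A1 ^+ 2) = A1 * (A2 * B1 - A1 * B2).
    by transitivity ((A1 * A2) * B1 - A1 ^+ 2 * B2); [rewrite hI; ring|ring].
  by rewrite pmulr_rle0// subr_le0.
have h2 : A1 ^+ 2 <= a * B1 ^+ 2.
  by move: h1; rewrite nmulr_rle0// subr_ge0.
have h3 : A2 ^+ 2 + a + 1 <= a * B2 ^+ 2 by lra.
have h4 : A1 ^+ 2 * (A2 ^+ 2 + a + 1) <= (a * B1 ^+ 2) * (a * B2 ^+ 2).
  by apply: ler_pM => //; [exact: sqr_ge0|have := sqr_ge0 A2; lra].
have h5 : (a * B1 ^+ 2) * (a * B2 ^+ 2) = (A1 * A2) ^+ 2 by rewrite hI; ring.
have : 0 < A1 ^+ 2 * (a + 1) by rewrite mulr_gt0 ?exprn_gt0 ?addr_gt0.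
move: h4; rewrite h5; lra.
Qed.

(* [A = coth phi] and [B = cot theta] for the common value
   [sin theta ^ 2 = a sinh phi ^ 2]; the conclusion says that, up to a joint sign,
   [exp phi] and [exp (i theta)] have modulus at least 1, not both equal to 1. *)
Lemma halfplane_sign (a : R) (A B : C) : 0 < a ->
  A ^+ 2 - 1 = a%:C * (B ^+ 2 + 1) ->
  normc (A + 'i * B) <= normc (A - 'i * B) ->
  [\/ 0 <= Re A /\ 0 <= Im B | Re A <= 0 /\ Im B <= 0] /\ (Re A != 0) || (Im B != 0).
Proof.
move: A B => [A1 A2] [B1 B2] a0 /eqP; rewrite !expr2 eq_complex /=.
move=> /andP[/eqP hR /eqP hI]; rewrite ler_sqrt ?addr_ge0 ?sqr_ge0// => hN.
have {}hR : A1 ^+ 2 - A2 ^+ 2 - 1 = a * (B1 ^+ 2 - B2 ^+ 2 + 1) by lra.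
have {}hI : A1 * A2 = a * (B1 * B2) by lra.
have {}hN : A2 * B1 <= A1 * B2 by lra.
split; last first.
  rewrite -negb_and; apply/negP => /andP[/eqP h1 /eqP h2].
  have := sqr_ge0 A2; have : 0 <= a * B1 ^+ 2 by rewrite mulr_ge0 ?sqr_ge0 ?ltW.
  by move: hR; rewrite h1 h2; lra.
have [hA|hA|hA] := ltrgtP A1 0.
- right; split => //.
  (* All relations are invariant under changing the sign of both [A] and [B]. *)
  rewrite -oppr_ge0; apply: (@halfplane_core a (- A1) (- A2) (- B1)) => //.
  + by rewrite !mulrNN.
  + by rewrite !sqrrN.
  + by rewrite !mulrNN.
  + by rewrite oppr_gt0.
- by left; split => //; exact: (@halfplane_core a A1 A2 B1).
- by case: (leP 0 B2) => [?|/ltW ?]; [left|right].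
Qed.

Lemma normc_eq0 (z : C) : (normc z == 0) = (z == 0).
Proof.
by apply/eqP/eqP => [/eq0_normc//|->]; rewrite [LHS]normc0.
Qed.

(** Read [s = sin theta], [X = cos theta], [s / b = sinh phi], [Ch = cosh phi], [n = 2k+1],
    [m = 2l+1]: the expression is [cos (n theta - i m phi)]. At a zero, the moduli of
    [exp (i theta)] and [exp phi], raised to the powers [n] and [m], have product 1. By
    [halfplane_sign] they lie on the same side of 1 and are not both 1, a contradiction. *)
Lemma cos_nonvanishing (a b : R) k l (X Ch s : C) : 0 < b -> a = b ^+ 2 ->
  X ^+ 2 = 1 - s ^+ 2 -> a%:C * Ch ^+ 2 = a%:C + s ^+ 2 ->
  normc (b%:C * Ch + 'i * X) <= normc (b%:C * Ch - 'i * X) ->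
  X * Ch * chc k (s ^+ 2) 1 * chc l (- (s ^+ 2 / a%:C)) 1
  + 'i * s ^+ 2 / b%:C * chs k (s ^+ 2) 1 * chs l (- (s ^+ 2 / a%:C)) 1 != 0.
Proof.
move=> b0 ab hX hC hN.
have a0 : 0 < a by rewrite ab exprn_gt0.
have bC0 : b%:C != 0 by rewrite (inj_eq (@complexI _) _ 0) lt0r_neq0.
have aC0 : a%:C != 0 by rewrite (inj_eq (@complexI _) _ 0) lt0r_neq0.
have abC : a%:C = b%:C ^+ 2 by rewrite ab rmorphXn.
have Ch2 : Ch ^+ 2 = 1 + s ^+ 2 / a%:C.
  by apply: (mulfI aC0); rewrite hC mulrDr mulr1 mulrCA divff// mulr1.
have ii : 'i ^+ 2 = -1 :> C by exact: sqr_i.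
(* For [s = 0] the cotangents below are undefined; there the expression is [X * Ch], whose square is
   1. *)
have [s0|s0] := eqVneq s 0.
  have [r ->] := chc_modx k (s ^+ 2) 1.
  have [r' ->] := chc_modx l (- (s ^+ 2 / a%:C)) 1.
  move: Ch2 hX; rewrite s0 expr0n /= !(mul0r, mulr0, subr0, addr0, oppr0, expr1n, mulr1).
  move=> hC1 hX1; apply: contraTneq (oner_neq0 C) => XC0.
  rewrite negbK -[1]mulr1 -{1}hX1 -hC1 -exprMn XC0.
  by rewrite expr0n.
set A := b%:C * Ch / s; set B := X / s.
have hA : A ^+ 2 = (a%:C + s ^+ 2) / s ^+ 2.
  by rewrite /A expr_div_n exprMn -abC hC.
have hB : B ^+ 2 = (1 - s ^+ 2) / s ^+ 2 by rewrite /B expr_div_n hX.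
have s2 : s ^+ 2 != 0 by rewrite expf_neq0.
have [] := @halfplane_sign a A B a0.
- by rewrite hA hB; field.
- have -> : A + 'i * B = (b%:C * Ch + 'i * X) / s by rewrite /A /B; field.
  have -> : A - 'i * B = (b%:C * Ch - 'i * X) / s by rewrite /A /B; field.
  by rewrite !normcM ler_wpM2r ?normc_ge0.
move=> hsgn hne.
set f := _ + _; apply/negP => /eqP f0.
(* [E] and [H] are [exp (i theta)] and [exp phi]; [E'] and [H'] are their inverses. *)
set E := X + 'i * s; set E' := X - 'i * s.
set H := Ch + s / b%:C; set H' := Ch - s / b%:C.
have EE : E * E' = 1.
  rewrite /E /E'; transitivity (X ^+ 2 - 'i ^+ 2 * s ^+ 2); first by ring.
  by rewrite hX ii; ring.
have HH : H * H' = 1.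
  rewrite /H /H'; transitivity (Ch ^+ 2 - s ^+ 2 / b%:C ^+ 2); first by field.
  by rewrite Ch2 -abC; ring.
have pE : E ^+ k.*2.+1 = X * chc k (s ^+ 2) 1 + 'i * s * chs k (s ^+ 2) 1.
  by apply: ch_pow; rewrite ?hX// exprMn ii mulN1r.
have pE' : E' ^+ k.*2.+1 = X * chc k (s ^+ 2) 1 - 'i * s * chs k (s ^+ 2) 1.
  by rewrite -mulNr; apply: ch_pow; rewrite ?hX// sqrrN exprMn ii mulN1r.
have pH : H ^+ l.*2.+1 = Ch * chc l (- (s ^+ 2 / a%:C)) 1
    + s / b%:C * chs l (- (s ^+ 2 / a%:C)) 1.
  by apply: ch_pow; rewrite opprK ?Ch2// expr_div_n abC.
have pH' : H' ^+ l.*2.+1 = Ch * chc l (- (s ^+ 2 / a%:C)) 1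
    - s / b%:C * chs l (- (s ^+ 2 / a%:C)) 1.
  by rewrite -[- (s / b%:C * _)]mulNr; 
    apply: ch_pow; rewrite opprK ?Ch2// sqrrN expr_div_n abC.
have Esum : E ^+ k.*2.+1 * H ^+ l.*2.+1 = - (E' ^+ k.*2.+1 * H' ^+ l.*2.+1).
  apply/eqP; rewrite -subr_eq0 opprK pE pE' pH pH'; apply/eqP.
  by transitivity (2 * f); [rewrite /f; field|rewrite f0 mulr0].
have nEE : normc E * normc E' = 1 by rewrite -normcM EE [LHS]normc1.
have nHH : normc H * normc H' = 1 by rewrite -normcM HH [LHS]normc1.
have nPP : normc E ^+ k.*2.+1 * normc H ^+ l.*2.+1 =
    normc E' ^+ k.*2.+1 * normc H' ^+ l.*2.+1.
  by rewrite -!normcX -!normcM Esum normcN.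
have nP : normc E ^+ k.*2.+1 * normc H ^+ l.*2.+1 = 1.
  apply/eqP; rewrite -(@eqrXn2 _ 2)//; last first.
    by rewrite mulr_ge0// exprn_ge0// normc_ge0.
  by rewrite expr1n expr2 {2}nPP mulrACA -!exprMn nEE nHH !expr1n mulr1.
have hE : E = s * (B + 'i) by rewrite /E /B; field.
have hE' : E' = s * (B - 'i) by rewrite /E' /B; field.
have hH : H = s / b%:C * (A + 1).
  by rewrite /H /A; field; rewrite bC0 s0.
have hH' : H' = s / b%:C * (A - 1).
  by rewrite /H' /A; field; rewrite bC0 s0.
have ns : 0 < normc s by rewrite lt_def normc_ge0 normc_eq0 s0.
have nsb : 0 < normc (s / b%:C).
  by rewrite lt_def normc_ge0 normc_eq0 mulf_neq0 ?invr_eq0.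
have cE : (normc E <= normc E') = (Im B <= 0).
  rewrite hE hE' !normcM ler_pM2l//; case: (B) => x1 x2 /=.
  by rewrite ler_sqrt ?addr_ge0 ?sqr_ge0//; apply/idP/idP; lra.
have cE' : (normc E' <= normc E) = (0 <= Im B).
  rewrite hE hE' !normcM ler_pM2l//; case: (B) => x1 x2 /=.
  by rewrite ler_sqrt ?addr_ge0 ?sqr_ge0//; apply/idP/idP; lra.
have cH : (normc H <= normc H') = (Re A <= 0).
  rewrite hH hH' !(normcM (s / b%:C)) ler_pM2l//; case: (A) => x1 x2 /=.
  by rewrite ler_sqrt ?addr_ge0 ?sqr_ge0//; apply/idP/idP; lra.
have cH' : (normc H' <= normc H) = (0 <= Re A).
  rewrite hH hH' !(normcM (s / b%:C)) ler_pM2l//; case: (A) => x1 x2 /=.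
  by rewrite ler_sqrt ?addr_ge0 ?sqr_ge0//; apply/idP/idP; lra.
(* The larger of two reciprocal numbers is at least 1, so a product of powers of two such numbers
   equals 1 only if both are 1. *)
have key (e e' h h' : R) : 0 <= e' -> 0 <= h' -> e' <= e -> h' <= h ->
    e * e' = 1 -> h * h' = 1 -> e ^+ k.*2.+1 * h ^+ l.*2.+1 = 1 -> e = 1 /\ h = 1.
  move=> e'0 h'0 ee hh e1 h1 p1.
  have ge1 (x x' : R) : 0 <= x' -> x' <= x -> x * x' = 1 -> 1 <= x.
    move=> x'0 xx x1; rewrite leNgt; apply/negP => lx.
    by have := ler_pM (le_trans x'0 xx) x'0 (ltW lx) (le_trans xx (ltW lx)); nra.
  have e2 := ge1 _ _ e'0 ee e1; have h2 := ge1 _ _ h'0 hh h1.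
  have E1 := exprn_ege1 k.*2.+1 e2; have H1 := exprn_ege1 l.*2.+1 h2.
  have E2 : e ^+ k.*2.+1 = 1 by nra.
  have H2 : h ^+ l.*2.+1 = 1 by move: p1; rewrite E2 mul1r.
  have x0 (x : R) : 1 <= x -> 0 <= x by apply: le_trans.
  by split; apply/eqP; [rewrite -(@pexpr_eq1 _ _ k.*2.+1) ?E2 ?x0
                       |rewrite -(@pexpr_eq1 _ _ l.*2.+1) ?H2 ?x0].
have fin : normc E = 1 /\ normc H = 1 -> False.
  move=> [e1 h1]; move: nEE nHH; rewrite e1 h1 !mul1r => e2 h2.
  move: hne; rewrite !eq_le -cE -cE' -cH -cH' e1 h1 e2 h2 lexx.
  by [].
case: hsgn => -[].
- rewrite -cH' -cE' => h1 h2; apply: fin.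
  by apply: (key _ (normc E') _ (normc H')); rewrite ?normc_ge0.
- rewrite -cH -cE => h1 h2; apply: fin.
  have nP' : normc E' ^+ k.*2.+1 * normc H' ^+ l.*2.+1 = 1.
    rewrite -[LHS]mul1r -{1}nP mulrACA -!exprMn nEE nHH !expr1n mulr1//.
  have [e1 e2] : normc E' = 1 /\ normc H' = 1.
    by apply: (key _ (normc E) _ (normc H)); rewrite ?normc_ge0// mulrC.
  by move: nEE nHH; rewrite e1 e2 !mulr1.
Qed.

End NonVanishing.

(** * Integrals against the arcsine weight *)

Section ArcsineWeight.
Variables (R : realType) (a : R).
Hypothesis a0 : 0 < a.
Local Notation mu := (@lebesgue_measure R).

(** The increasing affine map of [[-a, 1]] onto [[-1, 1]]; composed with [acos] it yields the angle
    [al] of the substitution. *)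
Definition itv_coord (t : R) : R := 2 / (1 + a) * t + (a - 1) / (1 + a).
Definition itv_point (al : R) : R := (1 - a) / 2 + (1 + a) / 2 * cos al.
Definition itv_angle (t : R) : R := acos (itv_coord t).
Definition itv_weight (t : R) : R := Num.sqrt ((1 - t) * (1 + t / a)).

Let a1 : 0 < 1 + a. Proof. by rewrite addr_gt0. Qed.
Let a1N : 1 + a != 0. Proof. by rewrite gt_eqF. Qed.
Let aN : a != 0. Proof. by rewrite gt_eqF. Qed.

Lemma itv_coord_point al : itv_coord (itv_point al) = cos al.
Proof. by rewrite /itv_coord /itv_point; field. Qed.

Lemma itv_coord_bound t : (- a <= t <= 1) = (-1 <= itv_coord t <= 1).
Proof.
have -> : itv_coord t = (2 * t + (a - 1)) / (1 + a).
  by rewrite /itv_coord; field.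
rewrite ler_pdivlMr// ler_pdivrMr//.
by congr (_ && _); apply/idP/idP; lra.
Qed.

Lemma itv_coord_bound_oo t : (- a < t < 1) = (-1 < itv_coord t < 1).
Proof.
have -> : itv_coord t = (2 * t + (a - 1)) / (1 + a).
  by rewrite /itv_coord; field.
rewrite ltr_pdivlMr// ltr_pdivrMr//.
by congr (_ && _); apply/idP/idP; lra.
Qed.

Lemma itv_angleK t : - a <= t <= 1 -> itv_point (itv_angle t) = t.
Proof.
rewrite itv_coord_bound => h; rewrite /itv_point /itv_angle acosK// /itv_coord.
by field.
Qed.

Lemma itv_pointK al : 0 <= al <= pi -> itv_angle (itv_point al) = al.
Proof. by move=> h; rewrite /itv_angle itv_coord_point cosK. Qed.

Lemma itv_weightE t :
  itv_weight t = (1 + a) / 2 / Num.sqrt a * Num.sqrt (1 - itv_coord t ^+ 2).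
Proof.
have sa : 0 < Num.sqrt a by rewrite sqrtr_gt0.
have c0 : 0 <= (1 + a) / 2 / Num.sqrt a.
  by rewrite !divr_ge0// ltW.
rewrite -{1}(ger0_norm c0) -sqrtr_sqr -sqrtrM ?sqr_ge0//; congr Num.sqrt.
rewrite !expr_div_n sqr_sqrtr ?ltW// /itv_coord; field.
by rewrite a1N aN.
Qed.

Lemma itv_weight_angle t : - a <= t <= 1 ->
  itv_weight t = (1 + a) / 2 / Num.sqrt a * sin (itv_angle t).
Proof. by move=> h; rewrite itv_weightE /itv_angle sin_acos// -itv_coord_bound. Qed.

Lemma itv_weight_gt0 t : - a < t < 1 -> 0 < itv_weight t.
Proof.
move=> /andP[h1 h2]; rewrite sqrtr_gt0 mulr_gt0 ?subr_gt0//.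
rewrite -(mulfV aN) -mulrDl divr_gt0//; lra.
Qed.

(** The substitution rule [dt / w = - sqrt a * d al], the source of the factor [sqrt a] in the
    integrals. *)
Lemma is_derive_itv_angle t : - a < t < 1 ->
  is_derive t 1 itv_angle (- (Num.sqrt a)^-1 / itv_weight t).
Proof.
move=> h; have h' := h; rewrite itv_coord_bound_oo in h'.
have w0 := itv_weight_gt0 t h.
have sa : 0 < Num.sqrt a by rewrite sqrtr_gt0.
have -> : - (Num.sqrt a)^-1 / itv_weight t
  = - (Num.sqrt (1 - itv_coord t ^+ 2))^-1 * (2 / (1 + a)).
  move: w0; rewrite itv_weightE pmulr_rgt0; last by rewrite !divr_gt0.
  by move=> w0; field; rewrite !lt0r_neq0.
apply: (@is_derive1_comp _ (@acos R) itv_coord).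
apply: is_derive_eq.
by rewrite addr0 /GRing.scale/= mulr1.
Qed.

Lemma continuous_itv_weight : continuous itv_weight.
Proof.
move=> t; apply: (@continuous_comp R R R (fun t => (1 - t) * (1 + t / a)) (@Num.sqrt R)).
  apply: cvgM; first by apply: cvgB; [exact: cvg_cst|exact: cvg_id].
  apply: cvgD; first exact: cvg_cst.
  by apply: cvgM; [exact: cvg_id|exact: cvg_cst].
exact: sqrt_continuous.
Qed.

Lemma continuous_itv_angle t : - a < t < 1 -> {for t, continuous itv_angle}.
Proof.
move=> h; apply: differentiable_continuous; apply/derivable1_diffP.
by have [] := is_derive_itv_angle t h.
Qed.

Lemma continuous_over_weight (g : R -> R) t : continuous g -> - a < t < 1 ->
  {for t, continuous (fun t => g (itv_angle t) / itv_weight t)}.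
Proof.
move=> cg h; apply: cvgM.
  apply: (@continuous_comp R R R itv_angle g); last exact: cg.
  exact: continuous_itv_angle.
apply: cvgV; last exact: continuous_itv_weight.
by rewrite gt_eqF// itv_weight_gt0.
Qed.

Lemma measurable_over_weight (g : R -> R) : continuous g ->
  measurable_fun `]- a, 1[ (fun t => g (itv_angle t) / itv_weight t).
Proof.
move=> cg; apply: open_continuous_measurable_fun; first exact: interval_open.
move=> t; rewrite inE /= in_itv /= => h.
exact: continuous_over_weight.
Qed.

Lemma itv_point_lt : {in `[0, pi]%R &, {mono itv_point : x y /~ x < y}}.
Proof.
move=> x y hx hy; rewrite /itv_point ltrD2l ltr_pM2l ?divr_gt0//.
by rewrite ltr_cos.
Qed.

(** The weight vanishes at both endpoints, so the open interval is exhausted by compact ones cut off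
    at angle [ang n] from each end. Starting at 1/2 keeps [ang n < pi - ang n]. *)
Let ang (n : nat) : R := n.+2%:R^-1.

Let ang_itv n : 0 < ang n < pi / 2.
Proof.
rewrite invr_gt0 ltr0n/=; apply: (@lt_le_trans _ _ 1).
  by rewrite invf_lt1// ltr1n.
by rewrite ler_pdivlMr// mul1r pi_ge2.
Qed.

Let ang_in n : (0 <= ang n <= pi) && (0 <= pi - ang n <= pi).
Proof. by have /andP[? ?] := ang_itv n; apply/andP; split; apply/andP; split; lra. Qed.

Let point_ang_lt n : itv_point (pi - ang n) < itv_point (ang n).
Proof.
have /andP[h1 h2] := ang_in n; rewrite itv_point_lt ?in_itv//=.
have := ang_itv n; lra.
Qed.

Let point_ang_itv n t : itv_point (pi - ang n) <= t <= itv_point (ang n) ->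
  - a < t < 1.
Proof.
move=> /andP[l1 l2]; have /andP[h1 h2] := ang_in n; have /andP[h3 h4] := ang_itv n.
have p0 : itv_point 0 = 1 by rewrite /itv_point cos0; lra.
have pp : itv_point pi = - a by rewrite /itv_point cospi; lra.
have pi0 : 0 <= pi :> R by apply: pi_ge0.
apply/andP; split.
  apply: lt_le_trans l1; rewrite -[ltLHS]pp itv_point_lt ?in_itv ?lexx ?pi0//=; lra.
apply: le_lt_trans l2 _; rewrite -[ltRHS]p0 itv_point_lt ?in_itv ?lexx ?pi0//=; lra.
Qed.

Let ang_cvg : ang n @[n --> \oo] --> 0.
Proof.
rewrite (@cvg_shiftS R (fun n => n.+1%:R^-1) (nbhs (0 : R))).
exact: cvg_harmonic.
Qed.

Let point_ang_bigcup :
  \bigcup_n `[itv_point (pi - ang n), itv_point (ang n)] = `]- a, 1[.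
Proof.
apply/seteqP; split => [t [n _]|t]; rewrite /= in_itv /= => h.
  by rewrite in_itv /=; exact: point_ang_itv h.
have hc : - a <= t <= 1 by move: h => /andP[? ?]; apply/andP; split; exact: ltW.
have h' := h; rewrite itv_coord_bound_oo in h'.
move: h' => /andP[h1 h2].
have b0 : 0 < itv_angle t by rewrite acos_gt0// (ltW h1).
have b1 : itv_angle t < pi by rewrite acos_ltpi// (ltW h2) h1.
have m0 : 0 < Num.min (itv_angle t) (pi - itv_angle t).
  by rewrite lt_min b0 subr_gt0.
have := ang_cvg => /cvgrPdist_lt/(_ _ m0)[n _ /(_ n (leqnn n))].
rewrite sub0r normrN ger0_norm; last by have := ang_itv n; lra.
rewrite lt_min => /andP[l1 l2]; exists n => //.
have /andP[r1 r2] := ang_in n.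
have r3 : 0 <= itv_angle t <= pi by rewrite !ltW.
rewrite /= in_itv /= -[t in X in X && _](itv_angleK _ hc) -[t in X in _ && X](itv_angleK _ hc).
by rewrite !ltW// itv_point_lt ?in_itv//; lra.
Qed.

(** On each compact interval the fundamental theorem applies with the antiderivative
    [- sqrt a * G (itv_angle t)]; as [g] is nonnegative, monotone convergence reaches the open
    interval. *)
Lemma integral_over_weight_ge0 (g G : R -> R) : continuous g ->
  (forall x : R, is_derive x 1 G (g x)) -> (forall x, 0 <= g x) ->
  (\int[mu]_(t in `](- a)%R, 1%R[) (g (itv_angle t) / itv_weight t)%R%:E =
   (Num.sqrt a * (G pi - G 0))%R%:E)%E.
Proof.
move=> cg dG g0; pose f t := g (itv_angle t) / itv_weight t.
have sa : 0 < Num.sqrt a by rewrite sqrtr_gt0.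
have dF t : - a < t < 1 ->
    is_derive t 1 (fun t => - Num.sqrt a * G (itv_angle t)) (f t).
  move=> h; have := is_derive_itv_angle t h => h1.
  have h2 := dG (itv_angle t).
  have h3 := is_derive1_comp h2 h1.
  have -> : f t = - Num.sqrt a * (g (itv_angle t) * (- (Num.sqrt a)^-1 / itv_weight t)).
    by rewrite /f; field; rewrite !lt0r_neq0// itv_weight_gt0.
  exact: is_deriveZ.
have I n : (\int[mu]_(t in `[itv_point (pi - ang n)%R, itv_point (ang n)]) (f t)%:E =
   (Num.sqrt a * (G (pi - ang n) - G (ang n)))%R%:E)%E.
  rewrite (@continuous_FTC2 _ f (fun t => - Num.sqrt a * G (itv_angle t))).
  - have /andP[h1 h2] := ang_in n.
    by rewrite !itv_pointK// -EFinB; congr EFin; ring.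
  - exact: point_ang_lt.
  - apply: continuous_in_subspaceT => t; rewrite inE /= in_itv /= => /point_ang_itv.
    exact: continuous_over_weight.
  - have : {within `[itv_point (pi - ang n), itv_point (ang n)],
         continuous (fun t => - Num.sqrt a * G (itv_angle t))}.
      apply: derivable_within_continuous => t; rewrite in_itv /= => /point_ang_itv /dF.
      by case.
    move=> /(continuous_within_itvP _ (point_ang_lt n))[_ c1 c2]; split => //.
    move=> t; rewrite in_itv /= => /andP[/ltW u /ltW v].
    by have := point_ang_itv n t; rewrite u v => /(_ isT)/dF[].
  - move=> t; rewrite in_itv /= => /andP[/ltW u /ltW v].
    have := point_ang_itv n t; rewrite u v => /(_ isT)/dF[] _.
    by rewrite derive1E.
have c : (\int[mu]_(t in `[itv_point (pi - ang n)%R, itv_point (ang n)]) (f t)%:E)%E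
    @[n --> \oo] --> (\int[mu]_(t in `](- a)%R, 1%R[) (f t)%:E)%E.
  rewrite -point_ang_bigcup; apply: ge0_nondecreasing_set_cvg_integral.
  - move=> n m nm; apply/subsetPset => t /=; rewrite !in_itv/= => /andP[l1 l2].
    have ? : ang m <= ang n by rewrite lef_pV2 ?posrE ?ltr0n// ler_nat.
    have /andP[h1 h2] := ang_in n; have /andP[h3 h4] := ang_in m.
    apply/andP; split; [apply: le_trans l1|apply: (le_trans l2)];
    rewrite leNgt itv_point_lt ?in_itv// -leNgt; lra.
  - by move=> n; exact: measurable_itv.
  - move=> n; apply/measurable_EFinP.
    apply: measurable_funS (measurable_over_weight g cg) => //.
    by move=> t /=; rewrite !in_itv /= => /point_ang_itv.
  - move=> n t /=; rewrite in_itv /= => /point_ang_itv h.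
    by rewrite lee_fin divr_ge0// ltW// itv_weight_gt0.
have cG x : {for x, continuous G}.
  by apply: differentiable_continuous; apply/derivable1_diffP; have [] := dG x.
rewrite (_ : (fun n => _) =
    (fun n => (Num.sqrt a * (G (pi - ang n) - G (ang n)))%:E)) in c; last first.
  by apply/funext => n; exact: I.
apply: (cvg_unique _ c) => //.
apply: cvg_EFin; first exact: nearW.
apply: cvgMr; apply: cvgB.
  have h : (pi - ang n : R) @[n --> \oo] --> (pi - 0 : R).
    by apply: cvgB; [exact: cvg_cst|exact: ang_cvg].
  by rewrite subr0 in h; apply: (cvg_comp _ _ h); exact: cG.
by apply: (cvg_comp _ _ ang_cvg); exact: cG.
Qed.

Lemma integrable_over_weight_ge0 (g G : R -> R) : continuous g ->
  (forall x : R, is_derive x 1 G (g x)) -> (forall x, 0 <= g x) ->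
  mu.-integrable `](- a)%R, 1%R[ (fun t => (g (itv_angle t) / itv_weight t)%:E).
Proof.
move=> cg dG g0; apply/integrableP; split.
  by apply/measurable_EFinP; exact: measurable_over_weight.
rewrite (_ : (\int[mu]_(t in _) _)%E = (Num.sqrt a * (G pi - G 0))%:E) ?ltry//.
rewrite -(integral_over_weight_ge0 _ _ cg dG g0); apply: eq_integral => t.
rewrite inE /= in_itv /= => h.
by rewrite ger0_norm// divr_ge0// ltW// itv_weight_gt0.
Qed.

Let sin_natpi (k : nat) : sin (k%:R * pi) = 0 :> R.
Proof.
elim: k => [|k IH]; first by rewrite mul0r sin0.
by rewrite -addn1 natrD mulrDl mul1r sinDpi IH oppr0.
Qed.

Lemma integral_cos_over_weight (k : nat) :
  mu.-integrable `](- a)%R, 1%R[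
    (fun t => (cos (k%:R * itv_angle t) / itv_weight t)%:E) /\
  (\int[mu]_(t in `](- a)%R, 1%R[) (cos (k%:R * itv_angle t) / itv_weight t)%R%:E =
   (if k == 0 then Num.sqrt a * pi else 0)%R%:E)%E.
Proof.
have i1 : continuous (fun _ : R => 1 : R) by move=> x; exact: cvg_cst.
have d1 x : is_derive x (1 : R) (fun y : R => y) 1 by exact: is_derive_id.
have [J1 I1] := conj (integrable_over_weight_ge0 _ _ i1 d1 (fun=> ler01))
                     (integral_over_weight_ge0 _ _ i1 d1 (fun=> ler01)).
case: eqP => [->|/eqP k0].
  have E t : cos (0%:R * itv_angle t) / itv_weight t = 1 / itv_weight t.
    by rewrite mul0r cos0.
  under eq_integral do rewrite E.
  rewrite I1 subr0; split => //.
  by apply: eq_integrable J1 => // t _; rewrite /= E.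
have kN : k%:R != 0 :> R by rewrite pnatr_eq0.
(* The cosine changes sign, so it is written as the difference of the nonnegative functions
   [1 + cos] and 1. *)
pose g (x : R) := 1 + cos (k%:R * x); pose G (x : R) := x + sin (k%:R * x) / k%:R.
have cg : continuous g.
  move=> x; apply: cvgD; first exact: cvg_cst.
  apply: (@continuous_comp R R R (fun x => k%:R * x) cos); last exact: continuous_cos.
  by apply: cvgM; [exact: cvg_cst|exact: cvg_id].
have dG (x : R) : is_derive x 1 G (g x).
  apply: is_deriveD; apply: is_derive_eq; rewrite !scaler0 add0r /GRing.scale/= mulr1.
  by field.
have g0 x : 0 <= g x by rewrite /g -lerBlDl sub0r cos_geN1.
have [J2 I2] := conj (integrable_over_weight_ge0 _ _ cg dG g0)
                     (integral_over_weight_ge0 _ _ cg dG g0).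
have E t : (cos (k%:R * itv_angle t) / itv_weight t)%:E =
  ((g (itv_angle t) / itv_weight t)%:E - (1 / itv_weight t)%:E)%E.
  by rewrite -EFinB -mulrBl /g addrC addKr.
have mD : measurable (`](- a)%R, 1%R[%classic : set R) by exact: measurable_itv.
split; first by under [X in _.-integrable _ X]eq_fun do rewrite E; exact: integrableB.
under eq_integral do rewrite E.
rewrite integralB_EFin// I1 I2 -EFinB /G mulr0 sin0 mul0r.
by rewrite sin_natpi mul0r !addr0 subrr.
Qed.

End ArcsineWeight.

(** * Passage to the limit from cosine sums *)

Section ArcsineLimit.
Variables (R : realType) (a : R).
Hypothesis a0 : 0 < a.
Local Notation mu := (@lebesgue_measure R).
Local Notation I := (`](- a)%R, 1%R[%classic : set R).
Local Notation ang := (itv_angle R a).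
Local Notation wgt := (itv_weight R a).

(* [lebesgue_measure] lives on the generated sigma-algebra type, whose display differs from
   the default one of [R]. *)
Let mI : @measurable _ (measurable_structure.g_sigma_algebraType
  (@measurable _ (lebesgue_stieltjes_measure.ocitv_type R))) I.
Proof. exact: measurable_itv. Qed.

Lemma integral_cos_sum_over_weight (c : nat -> R) m :
  mu.-integrable I
    (fun t => ((\sum_(k < m) c k * cos (k%:R * ang t)) / wgt t)%:E) /\
  (\int[mu]_(t in I) ((\sum_(k < m) c k * cos (k%:R * ang t)) / wgt t)%R%:E =
   (\sum_(k < m) c k * (if k == 0%N :> nat then Num.sqrt a * pi else 0))%R%:E)%E.
Proof.
elim: m => [|m [J E]].
  rewrite !big_ord0.
  have Z t : (\sum_(k < 0) c k * cos (k%:R * ang t)) / wgt t = 0.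
    by rewrite big_ord0 mul0r.
  under eq_integral do rewrite Z.
  rewrite integral0; split => //.
  by apply: (eq_integrable mI (cst 0%E)) (integrable0 mu I) => t _; rewrite /= Z.
have [Jm Em] := integral_cos_over_weight _ _ a0 m.
have S t : ((\sum_(k < m.+1) c k * cos (k%:R * ang t)) / wgt t)%:E =
  (((\sum_(k < m) c k * cos (k%:R * ang t)) / wgt t)%:E
   + (c m)%:E * (cos (m%:R * ang t) / wgt t)%:E)%E.
  by rewrite big_ord_recr /= mulrDl EFinD -mulrA EFinM.
have Jc := integrableZl mI (c m) Jm.
split; first by under [X in _.-integrable _ X]eq_fun do rewrite S; exact: integrableD.
under eq_integral do rewrite S.
by rewrite (integralD mI J Jc) E integralZl// Em big_ord_recr.
Qed.

(** The integral of a cosine sum over the weight sees only its constant coefficient. Dominated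
    convergence along approximations with tolerance [1 / (n + 1)] carries this over to [r].
    Excluding [t = 0] from the formula for [h] leaves room for the factor [1 / t]. *)
Lemma integral_cos_limit_over_weight (r h : R -> R) (L : R) :
  (forall e : R, 0 < e -> exists2 A : {poly R},
     forall al, `|r al - \sum_(k < size A) A`_k * cos (k%:R * al)| <= e
   & `|L - A`_0| <= e) ->
  (forall t, - a < t < 1 -> t != 0 -> h t = r (ang t) / wgt t) ->
  mu.-integrable (`[(- a)%R, 1%R]%classic : set R) (fun t => (h t)%:E) /\
  (\int[mu]_(t in `[(- a)%R, 1%R]) (h t)%:E = (Num.sqrt a * pi * L)%R%:E)%E.
Proof.
move=> happ hh.
have hex (n : nat) : exists A : {poly R},
    (forall al, `|r al - \sum_(k < size A) A`_k * cos (k%:R * al)| <= n.+1%:R^-1) /\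
    `|L - A`_0| <= n.+1%:R^-1.
  have n0 : 0 < n.+1%:R^-1 :> R by rewrite invr_gt0.
  by have [A h1 h2] := happ _ n0; exists A; split.
have [A hA] := choice hex.
pose P n (t : R) := (\sum_(k < size (A n)) (A n)`_k * cos (k%:R * ang t)) / wgt t.
pose S := I `\ (0 : R).
have mS : measurable S by apply: measurableD => //; exact: measurable_set1.
have SI : S `<=` I by exact: subDsetl.
have JP n : mu.-integrable I (fun t => (P n t)%:E).
  by have [] := integral_cos_sum_over_weight (fun k => (A n)`_k) (size (A n)).
have EP n : (\int[mu]_(t in I) (P n t)%:E = (Num.sqrt a * pi * (A n)`_0)%R%:E)%E.
  have [_ ->] := integral_cos_sum_over_weight (fun k => (A n)`_k) (size (A n)).
  congr EFin; case E : (size (A n)) => [|s].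
    by rewrite big_ord0 nth_default ?E// mulr0.
  rewrite big_ord_recl big1 => [|i _]; last by rewrite mulr0.
  by rewrite addr0 mulrC.
have S_itv t : S t -> (- a < t < 1) /\ t != 0.
  by move=> [/=]; rewrite in_itv /= => ti /eqP ?; split.
have hP t n : S t -> `|h t - P n t| <= n.+1%:R^-1 / wgt t.
  move=> /S_itv[h1 h2]; have w0 := itv_weight_gt0 _ _ a0 _ h1.
  rewrite hh// /P -mulrBl normrM normfV (ger0_norm (ltW w0)) ler_pM2r ?invr_gt0//.
  by have [] := hA n.
have cP t : S t -> (P n t)%:E @[n --> \oo] --> (h t)%:E.
  move=> St; have [h1 h2] := S_itv _ St; have w0 := itv_weight_gt0 _ _ a0 _ h1.
  apply: cvg_EFin; first exact: nearW.
  apply/cvgrPdist_le => e e0.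
  have := @cvg_harmonic R => /cvgrPdist_le/(_ (e * wgt t)) /(_ (mulr_gt0 e0 w0)).
  case=> K _ hK; exists K => // n /= Kn; apply: le_trans (hP t n St) _.
  rewrite ler_pdivrMr//; have := hK n Kn.
  by rewrite /harmonic /= sub0r normrN ger0_norm.
have mP n : measurable_fun S (fun t => (P n t)%:E).
  by apply: measurable_funS (measurable_int mu (JP n)).
(* Nothing is assumed on the regularity of [h]; its measurability comes from being a pointwise
   limit. *)
have mh : measurable_fun S (fun t => (h t)%:E).
  by apply: (emeasurable_fun_cvg (fun n t => (P n t)%:E)) => // t /cP.
have [B hB] : exists B, forall al, `|r al| <= B.
  exists (1 + \sum_(k < size (A 0%N)) `|(A 0%N)`_k|) => al.
  rewrite -(subrK (\sum_(k < size (A 0%N)) (A 0%N)`_k * cos (k%:R * al)) (r al)).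
  apply: le_trans (ler_normD _ _) _; apply: lerD.
    by have [/(_ al)] := hA 0%N; rewrite invr1.
  apply: le_trans (ler_norm_sum _ _ _) _; apply: ler_sum => k _.
  by rewrite normrM ler_piMr// ler_norml cos_geN1 cos_le1.
(* The dominating function: every approximation is within 1 of [r], which is bounded by [B]. *)
have Jg : mu.-integrable S (fun t => ((B + 1) * (1 / wgt t))%:E).
  have [J _] := integral_cos_over_weight _ _ a0 0.
  have := integrableZl mI (B + 1) J.
  move=> /(integrableS mI mS SI); apply: eq_integrable => // t _ /=.
  by rewrite mul0r cos0 EFinM.
have dom t n : S t -> (`|(P n t)%:E| <= ((B + 1) * (1 / wgt t))%:E)%E.
  move=> St; have [h1 h2] := S_itv _ St; have w0 := itv_weight_gt0 _ _ a0 _ h1.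
  rewrite abse_EFin lee_fin /P normrM normfV (ger0_norm (ltW w0)) mul1r.
  rewrite ler_pM2r ?invr_gt0//.
  set p := \sum_(_ < _) _; rewrite -(subrK (r (ang t)) p) addrC.
  apply: le_trans (ler_normD _ _) _; apply: lerD => //.
  have [/(_ (ang t)) + _] := hA n; rewrite distrC => /le_trans; apply.
  by rewrite invf_le1 ?ler1n.
have [||||| Jh _ Ch] := @dominated_convergence _ _ _ mu S mS (fun n t => (P n t)%:E)
  (fun t => (h t)%:E) (fun t => ((B + 1) * (1 / wgt t))%:E) => //.
- by apply/aeW => t; exact: cP.
- by apply/aeW => t n; exact: dom.
have Eh : (\int[mu]_(t in S) (h t)%:E = (Num.sqrt a * pi * L)%R%:E)%E.
  apply: (cvg_unique _ Ch) => //=.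
  rewrite (_ : (fun n => _) = (fun n => (Num.sqrt a * pi * (A n)`_0)%:E)).
    apply: cvg_EFin; first exact: nearW.
    apply: cvgMr; apply/cvgrPdist_le => e e0.
    have := @cvg_harmonic R => /cvgrPdist_le/(_ _ e0)[K _ hK].
    exists K => // n /= Kn; have [_ h1] := hA n; apply: le_trans h1 _.
    by have := hK n Kn; rewrite /harmonic /= sub0r normrN ger0_norm.
  apply/funext => n; rewrite -EP integral_setD1//.
(* The finite, hence null, set where [h] is not controlled. *)
pose N : set R := [set - a] `|` [set 0] `|` [set 1].
have mN : measurable N.
  by apply: measurableU; [apply: measurableU|]; exact: measurable_set1.
have N0 : mu N = 0%E.
  have s0 x : mu [set x] = 0%E by exact: lebesgue_measure_set1.
  apply: null_set_setU; [|exact: measurable_set1| |exact: s0].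
    by apply: measurableU; exact: measurable_set1.
  by apply: null_set_setU; [exact: measurable_set1..|exact: s0|exact: s0].
have DN : `[(- a)%R, 1%R] `\` N = S.
  apply/seteqP; split => t; rewrite /N /S /= !in_itv /=.
    move=> [/andP[h1 h2] h3]; split; last by move=> e; apply: h3; left; right.
    rewrite !lt_neqAle h1 h2 !andbT; apply/andP; split; apply/eqP => e; apply: h3.
      by left; left.
    by right.
  move=> [/andP[h1 h2] h3]; split; first by rewrite !ltW.
  by move=> [[e|e]|e]; [move: h1; rewrite e ltxx|exact: h3|move: h2; rewrite e ltxx].
have mh1 : measurable_fun (`[(- a)%R, 1%R]%classic : set R) (fun t => (h t)%:E).
  apply: (@measurable_funS _ _ _ _ (S `|` N)).
  - exact: measurableU.
  - by rewrite -DN setUC => t tD; have [|] := pselect (N t); [left|right].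
  - apply/measurable_funU => //; split => //.
    apply/measurable_funU; [|exact: measurable_set1|].
      by apply: measurableU; exact: measurable_set1.
    split; last exact: measurable_fun_set1.
    by apply/measurable_funU; [exact: measurable_set1..|split; exact: measurable_fun_set1].
have mD : measurable (`[(- a)%R, 1%R]%classic : set R) by exact: measurable_itv.
have J1 : mu.-integrable (`[(- a)%R, 1%R]%classic : set R) (fun t => (h t)%:E).
  have [_] := @negligible_integrable _ _ _ mu _ N _ mN mD mh1 N0.
  by rewrite DN; apply.
split => //.
by have := @negligible_integral _ _ _ mu _ N _ mN mD J1 N0; rewrite DN Eh.
Qed.

End ArcsineLimit.

(** * Odd multiples of circular and hyperbolic angles *)

Section OddMultiples.
Local Open Scope complex_scope.
Variable R : realType.
Implicit Types x y th : R.

Lemma cos_sin_odd k th :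
  cos (k.*2.+1%:R * th) = cos th * chc k (sin th ^+ 2) 1 /\
  sin (k.*2.+1%:R * th) = sin th * chs k (sin th ^+ 2) 1.
Proof.
elim: k => [|k [IHc IHs]]; first by rewrite !mul1r !mulr1.
have -> : k.+1.*2.+1%:R * th = k.*2.+1%:R * th + (th + th).
  by rewrite doubleS -addn2 natrD mulrDl; congr (_ + _); rewrite mulr_natl.
rewrite (cosD (_ * _)) (sinD (_ * _)) IHc IHs cosD sinD chcS chsS.
have := cos2sin2 th; rewrite expr2 => e.
split.
  rewrite e.
  transitivity (cos th * (1 - 2 * sin th ^+ 2) * chc k (sin th ^+ 2) 1
     - 2 * sin th ^+ 2 * cos th * chs k (sin th ^+ 2) 1); ring.
transitivity (sin th * (cos th * cos th - sin th ^+ 2) * chs k (sin th ^+ 2) 1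
     + 2 * (cos th * cos th) * sin th * chc k (sin th ^+ 2) 1); first by ring.
by rewrite e; ring.
Qed.

Lemma coshR2 x : coshR x ^+ 2 = 1 + sinhR x ^+ 2.
Proof.
have e := expRxMexpNx_1 x; rewrite /coshR /sinhR.
transitivity (expR x * expR (- x) + ((expR x - expR (- x)) / 2) ^+ 2); first by field.
by rewrite e.
Qed.

Lemma coshR_sinhR_odd k x :
  coshR (k.*2.+1%:R * x) = coshR x * chc k (- sinhR x ^+ 2) 1 /\
  sinhR (k.*2.+1%:R * x) = sinhR x * chs k (- sinhR x ^+ 2) 1.
Proof.
have hc : coshR x ^+ 2 = 1 - - sinhR x ^+ 2 by rewrite opprK coshR2.
have p1 : expR (k.*2.+1%:R * x) =
    coshR x * chc k (- sinhR x ^+ 2) 1 + sinhR x * chs k (- sinhR x ^+ 2) 1.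
  have -> : expR (k.*2.+1%:R * x) = (coshR x + sinhR x) ^+ k.*2.+1.
    by rewrite expRM_natl; congr (_ ^+ _); rewrite /coshR /sinhR; field.
  by apply: ch_pow => //; rewrite opprK.
have p2 : expR (- (k.*2.+1%:R * x)) =
    coshR x * chc k (- sinhR x ^+ 2) 1 - sinhR x * chs k (- sinhR x ^+ 2) 1.
  have -> : expR (- (k.*2.+1%:R * x)) = (coshR x + - sinhR x) ^+ k.*2.+1.
    by rewrite -mulrN expRM_natl; congr (_ ^+ _); rewrite /coshR /sinhR; field.
  by rewrite -[- (sinhR x * _)]mulNr; apply: ch_pow => //; rewrite opprK sqrrN.
by rewrite {1}/coshR {2}/sinhR p1 p2; split; field.
Qed.

Lemma sinhR_asinhR y : sinhR (asinhR y) = y.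
Proof.
set s := Num.sqrt (y ^+ 2 + 1).
have s2 : s ^+ 2 = y ^+ 2 + 1 by rewrite sqr_sqrtr// addr_ge0 ?sqr_ge0.
have ys : 0 < y + s.
  rewrite -ltrBlDl sub0r; apply: le_lt_trans (ler_norm _) _.
  by rewrite normrN -sqrtr_sqr ltr_sqrt ?ltr_pwDr ?sqr_ge0// ltrDl.
rewrite /sinhR /asinhR -/s expRN lnK ?posrE//.
have -> : (y + s)^-1 = s - y.
  apply: (mulfI (lt0r_neq0 ys)); rewrite mulfV ?lt0r_neq0//.
  by transitivity (s ^+ 2 - y ^+ 2); [rewrite s2; ring|ring].
by field.
Qed.

Lemma coshR_asinhR y : coshR (asinhR y) = Num.sqrt (1 + y ^+ 2).
Proof.
rewrite -[in RHS](sinhR_asinhR y) -coshR2 sqrtr_sqr ger0_norm//.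
by rewrite divr_ge0// addr_ge0// ltW// expR_gt0.
Qed.

(** With [p, q = cosh x, sinh x] and [p', q' = cos y, sin y] this says that [cosh 2x + cos 2y] is
    twice the squared modulus of [cos (y + i x)]. *)
Let rho_identity (p q p' q' : R) : p ^+ 2 = 1 + q ^+ 2 -> q' ^+ 2 = 1 - p' ^+ 2 ->
  2 * p ^+ 2 - 1 + (2 * p' ^+ 2 - 1) = 2 * ((p * p') ^+ 2 + (q * q') ^+ 2).
Proof. by move=> e e'; rewrite !exprMn e e'; ring. Qed.

Lemma cos_natdouble n th : cos ((2 * n)%:R * th) = 2 * cos (n%:R * th) ^+ 2 - 1.
Proof.
by rewrite natrM -mulrA mulr_natl mulr2n cosD -!expr2 sin2cos2; ring.
Qed.

Lemma coshR_natdouble n x : coshR ((2 * n)%:R * x) = 2 * coshR (n%:R * x) ^+ 2 - 1.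
Proof.
rewrite natrM -mulrA; set y := n%:R * x.
have e := expRxMexpNx_1 y; rewrite /coshR.
have -> : - (2 * y) = - y + - y by ring.
rewrite (_ : 2 * y = y + y); last by ring.
rewrite !expRD.
transitivity (2 * ((expR y + expR (- y)) / 2) ^+ 2 - expR y * expR (- y)); first by field.
by rewrite e.
Qed.

Lemma SS_CC_rho k l (a t : R) : 0 < a -> - a <= t <= 1 ->
  [/\ SS k.*2.+1 l.*2.+1 a t =
       t / Num.sqrt a * (chs k t 1 * chs l (- (t / a)) 1),
      CC k.*2.+1 l.*2.+1 a t =
       itv_weight R a t * (chc k t 1 * chc l (- (t / a)) 1)
    & rho k.*2.+1 l.*2.+1 a t =
       2 * (CC k.*2.+1 l.*2.+1 a t ^+ 2 + SS k.*2.+1 l.*2.+1 a t ^+ 2)].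
Proof.
move=> a0 /andP[ta t1].
have ia : 0 <= a^-1 by rewrite invr_ge0 ltW.
have t1' : 0 <= 1 - t by rewrite subr_ge0.
have w : itv_weight R a t = Num.sqrt (1 - t) * Num.sqrt (1 + t / a).
  by rewrite -sqrtrM.
have sa : Num.sqrt a * Num.sqrt a = a by rewrite -expr2 sqr_sqrtr// ltW.
have sa0 : Num.sqrt a != 0 by rewrite gt_eqF// sqrtr_gt0.
have asin1 y : 0 <= y <= 1 -> sin (asin (Num.sqrt y)) = Num.sqrt y /\
    cos (asin (Num.sqrt y)) = Num.sqrt (1 - y).
  move=> /andP[y0 y1].
  have h : -1 <= Num.sqrt y <= 1.
    rewrite (le_trans _ (sqrtr_ge0 y)) ?lerN10//=.
    by rewrite -[leRHS]sqrtr1 ler_wsqrtr.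
  by rewrite asinK ?in_itv// cos_asin// sqr_sqrtr.
rewrite /SS /CC /rho; case: ifPn => [t0|]; last first.
  rewrite -ltNge => t0.
  have mt : 0 <= - t by rewrite oppr_ge0 ltW.
  have [|s1 c1] := asin1 (- t / a).
    by rewrite mulr_ge0//= ler_pdivrMr// mul1r lerNl.
  rewrite cos_natdouble coshR_natdouble.
  have [cc ss] := cos_sin_odd l (asin (Num.sqrt (- t / a))).
  have [hc hs] := coshR_sinhR_odd k (asinhR (Num.sqrt (- t))).
  have := sin2cos2 (l.*2.+1%:R * asin (Num.sqrt (- t / a))).
  have := coshR2 (k.*2.+1%:R * asinhR (Num.sqrt (- t))).
  rewrite cc ss hc hs sinhR_asinhR coshR_asinhR s1 c1 !sqr_sqrtr ?mulr_ge0// opprK.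
  rewrite mulNr opprK => e e'.
  split; last by rewrite sqrrN; exact: rho_identity.
    (* This sign cancels the minus sign in [SS] for negative [t], so both branches yield the same
       polynomial. *)
    have pr : Num.sqrt (- t) * Num.sqrt (- (t / a)) = - (t / Num.sqrt a).
      by rewrite -mulNr sqrtrM// sqrtrV ?ltW// mulrA -expr2 sqr_sqrtr// mulNr.
    by rewrite mulrACA pr mulNr opprK.
  by rewrite mulrACA w.
have [|s1 c1] := asin1 t; first by rewrite t0.
rewrite cos_natdouble coshR_natdouble.
have [cc ss] := cos_sin_odd k (asin (Num.sqrt t)).
have [hc hs] := coshR_sinhR_odd l (asinhR (Num.sqrt (t / a))).
have := sin2cos2 (k.*2.+1%:R * asin (Num.sqrt t)).
have := coshR2 (l.*2.+1%:R * asinhR (Num.sqrt (t / a))).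
rewrite cc ss hc hs sinhR_asinhR coshR_asinhR s1 c1 !sqr_sqrtr ?mulr_ge0// => e e'.
split.
- have pr : Num.sqrt t * Num.sqrt (t / a) = t / Num.sqrt a.
    by rewrite sqrtrM// sqrtrV ?ltW// mulrA -expr2 sqr_sqrtr.
  by rewrite mulrACA pr.
- by rewrite mulrACA w.
- by rewrite addrC (rho_identity _ _ _ _ e e'); ring.
Qed.

End OddMultiples.

(** * The denominator on the unit circle *)

Section Denominator.
Local Open Scope complex_scope.
Variables (R : realType) (a : R) (k l : nat).
Hypothesis a0 : 0 < a.
Local Notation C := R[i].
Local Notation toC := (real_complex R).
Local Notation ev u P := (map_poly toC P).[u].
Local Notation b := (Num.sqrt a).
Local Notation c := ((1 + a) / 4).

(* On the unit circle [u = exp (i al)] one has [t = Tp u / u],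
   [sqrt ((1 - t) (1 + t / a)) = i Vp u / u] and
   [CC + i SS = i Qp u / u ^ (k + l + 1)]. *)
Definition Tp : {poly R} := 'X + c%:P * (1 - 'X) ^+ 2.
Definition Vp : {poly R} := (c / b)%:P * (1 - 'X ^+ 2).
Definition Tm : {poly R} := - (a^-1%:P * Tp).
Definition Qp : {poly R} :=
  Vp * (chc k Tp 'X * chc l Tm 'X) + b^-1%:P * Tp * (chs k Tp 'X * chs l Tm 'X).

Let b0 : 0 < b. Proof. by rewrite sqrtr_gt0. Qed.
Let bb : a = b ^+ 2. Proof. by rewrite sqr_sqrtr// ltW. Qed.
Let aN : a != 0. Proof. by rewrite gt_eqF. Qed.
Let bN : b != 0. Proof. by rewrite gt_eqF. Qed.
Let c0 : 0 < c. Proof. by rewrite divr_gt0// addr_gt0. Qed.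

Lemma evD u P S : ev u (P + S) = ev u P + ev u S.
Proof. by rewrite rmorphD hornerD. Qed.
Lemma evN u P : ev u (- P) = - ev u P.
Proof. by rewrite rmorphN hornerN. Qed.
Lemma evM u P S : ev u (P * S) = ev u P * ev u S.
Proof. by rewrite rmorphM hornerM. Qed.
Lemma evXn u P j : ev u (P ^+ j) = ev u P ^+ j.
Proof. by rewrite rmorphXn horner_exp. Qed.
Lemma evC u x : ev u x%:P = x%:C.
Proof. by rewrite map_polyC hornerC. Qed.
Lemma ev1 u : ev u 1 = 1.
Proof. by rewrite rmorph1 hornerC. Qed.
Lemma evX u : ev u 'X = u.
Proof. by rewrite map_polyX hornerX. Qed.
Let evE := (evD, evN, evM, evXn, evC, ev1, evX).

Lemma ev_Tp u : ev u Tp = u + c%:C * (1 - u) ^+ 2.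
Proof. by rewrite /Tp !evE. Qed.

Lemma ev_Vp u : ev u Vp = (c / b)%:C * (1 - u ^+ 2).
Proof. by rewrite /Vp !evE. Qed.

Lemma ev_Tm u : ev u Tm = - (ev u Tp / a%:C).
Proof. by rewrite /Tm !(evN, evM, evC) fmorphV mulrC. Qed.

Lemma ev_ch j (P S : {poly R}) u :
  ev u (chc j P S) = chc j (ev u P) (ev u S) /\
  ev u (chs j P S) = chs j (ev u P) (ev u S).
Proof.
have [h1 h2] := ch_rmorph _ _ (map_poly toC) j P S.
have [h3 h4] := ch_rmorph _ _ (horner_eval u) j (map_poly toC P) (map_poly toC S).
by rewrite h1 h2; split; [exact: h3|exact: h4].
Qed.

Lemma ev_Qp u : ev u Qp =
  ev u Vp * (chc k (ev u Tp) u * chc l (- (ev u Tp / a%:C)) u)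
  + ev u Tp / b%:C * (chs k (ev u Tp) u * chs l (- (ev u Tp / a%:C)) u).
Proof.
have [c1 s1] := ev_ch k Tp 'X u; have [c2 s2] := ev_ch l Tm 'X u.
rewrite evX ev_Tm in c2 s2; rewrite evX in c1 s1.
rewrite /Qp evD (evM _ Vp) (evM _ (chc _ _ _)) (evM _ (_ * Tp)) (evM _ _ Tp).
rewrite evC (evM _ (chs _ _ _)) c1 s1 c2 s2.
by rewrite fmorphV [b%:C^-1 * _]mulrC.
Qed.

Lemma ev_Qp_scaled u t : ev u Tp = u * t ->
  ev u Qp = u ^+ (k + l) *
  (ev u Vp * (chc k t 1 * chc l (- (t / a%:C)) 1)
   + u * t / b%:C * (chs k t 1 * chs l (- (t / a%:C)) 1)).
Proof.
move=> E; rewrite ev_Qp E.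
have -> : - (u * t / a%:C) = u * - (t / a%:C) by rewrite mulrN mulrA.
have [c1 s1] := ch_scale _ u k t 1; have [c2 s2] := ch_scale _ u l (- (t / a%:C)) 1.
rewrite mulr1 in c1 s1 c2 s2.
by rewrite c1 s1 c2 s2 exprD; ring.
Qed.

Lemma Tp0 : Tp.[0] = c.
Proof.
rewrite /Tp !(horner_exp, hornerD, hornerN, hornerM, hornerC, hornerX).
by rewrite subr0 expr1n add0r mulr1.
Qed.

Lemma Vp0 : Vp.[0] = c / b.
Proof.
rewrite /Vp !(horner_exp, hornerD, hornerN, hornerM, hornerC, hornerX).
by rewrite expr0n subr0 mulr1.
Qed.

Lemma Tm0 : Tm.[0] = - (c / a).
Proof. by rewrite /Tm hornerN hornerM hornerC Tp0 mulrC. Qed.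

Lemma Qp0_neq0 : Qp.[0] != 0.
Proof.
have [c1 s1] := ch_rmorph _ _ (horner_eval (0 : R)) k Tp 'X.
have [c2 s2] := ch_rmorph _ _ (horner_eval (0 : R)) l Tm 'X.
move: c1 s1 c2 s2; rewrite /= /horner_eval.
rewrite Tp0 Tm0 hornerX.
have [-> ->] := ch_at0 _ k c.
have [-> ->] := ch_at0 _ l (- (c / a)).
move=> c1 s1 c2 s2.
rewrite /Qp hornerD (hornerM Vp) (hornerM (chc _ _ _)) (hornerM _ (_ * _)) (hornerM _ Tp).
rewrite (hornerM (chs _ _ _)) c1 s1 c2 s2 Tp0 Vp0 hornerC.
set x := (- 4 * c) ^+ k * _.
have -> : c / b * x + b^-1 * c * x = 2 * (c / b) * x by field.
have cN : c != 0 by rewrite gt_eqF.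
have n4 : - 4 != 0 :> R by rewrite oppr_eq0 pnatr_eq0.
have dN : - (c / a) != 0 by rewrite oppr_eq0 mulf_neq0 ?invr_eq0.
have xN : x != 0 by apply: mulf_neq0; apply: expf_neq0; apply: mulf_neq0.
by rewrite mulf_neq0// mulf_neq0 ?pnatr_eq0// mulf_neq0 ?invr_eq0.
Qed.

(** Away from [u = 0], [Qp] is a nonzero multiple of the cosine in [cos_nonvanishing], with
    [s ^+ 2 = Tp u / u]. The condition that [u] lies in the disc becomes the modulus inequality
    required there. *)
Lemma Qp_nonvanishing u : normc u <= 1 -> ev u Qp != 0.
Proof.
move=> hu; have [->|u0] := eqVneq u 0.
  rewrite -(rmorph0 toC) horner_map /= (inj_eq (@complexI _) _ 0).
  exact: Qp0_neq0.
set s := sqrtc (ev u Tp / u).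
have s2 : s ^+ 2 = ev u Tp / u by rewrite sqr_sqrtc.
have E : ev u Tp = u * s ^+ 2 by rewrite s2 mulrC divfK.
rewrite (ev_Qp_scaled _ _ E) mulf_neq0 ?expf_neq0//.
set r := Num.sqrt (1 + a).
have r2 : r ^+ 2 = 1 + a by rewrite sqr_sqrtr// addr_ge0// ltW.
set z := sqrtc u; have z2 : z ^+ 2 = u by rewrite sqr_sqrtc.
have z0 : z != 0 by apply: contraNneq u0 => e; rewrite -z2 e expr0n.
(* [X] and [Ch] solve [b * Ch + 'i * X = r * z] and [b * Ch - 'i * X = r / z], so the modulus
   inequality is just [normc z <= 1]. *)
set X := r%:C * (z - z^-1) / (2 * 'i).
set Ch := r%:C * (z + z^-1) / (2 * b%:C).
have ii : 'i ^+ 2 = -1 :> C by exact: sqr_i.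
have iN : 'i != 0 :> C by rewrite -sqrf_eq0 ii oppr_eq0 oner_eq0.
have bCN : b%:C != 0 by rewrite (inj_eq (@complexI _) _ 0).
have aCN : a%:C != 0 by rewrite (inj_eq (@complexI _) _ 0).
have aC : a%:C = b%:C ^+ 2 by rewrite {1}bb rmorphXn.
have cC : c%:C = r%:C ^+ 2 / 4.
  by rewrite -rmorphXn r2 rmorphM fmorphV rmorph_nat.
have rC : r%:C ^+ 2 = 1 + a%:C by rewrite -rmorphXn r2 rmorphD rmorph1.
have s2z : s ^+ 2 = 1 + r%:C ^+ 2 / 4 * (z - z^-1) ^+ 2.
  by rewrite s2 ev_Tp cC -z2; field.
have iV : 'i^-1 = - 'i :> C.
  by apply: (mulfI iN); rewrite mulfV// mulrN -expr2 ii opprK.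
have hX : X ^+ 2 = 1 - s ^+ 2.
  rewrite s2z /X; transitivity (r%:C ^+ 2 * (z - z^-1) ^+ 2 / (4 * 'i ^+ 2)).
    by field; rewrite ?z0 ?iN.
  by rewrite ii; field.
have hC : a%:C * Ch ^+ 2 = a%:C + s ^+ 2.
  have -> : a%:C = r%:C ^+ 2 - 1 by rewrite rC; ring.
  have e : r%:C ^+ 2 - 1 = b%:C ^+ 2 by rewrite rC -aC; ring.
  rewrite s2z {1}e /Ch; field.
  by rewrite z0 bCN.
have hp : b%:C * Ch + 'i * X = r%:C * z by rewrite /Ch /X; field; rewrite ?iN ?bCN ?z0 ?u0.
have hm : b%:C * Ch - 'i * X = r%:C * z^-1 by rewrite /Ch /X; field; rewrite ?iN ?bCN ?z0 ?u0.
have nz : normc z <= 1.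
  rewrite -(@ler_pXn2r _ 2)// ?nnegrE ?normc_ge0//.
  by rewrite expr1n -normcX z2.
have hN : normc (b%:C * Ch + 'i * X) <= normc (b%:C * Ch - 'i * X).
  rewrite hp hm !normcM normcV ler_wpM2l ?normc_ge0//.
  have nz0 : 0 < normc z by rewrite lt_def normc_eq0 z0 normc_ge0.
  by apply: (le_trans nz); rewrite invf_ge1.
have := cos_nonvanishing _ _ _ k l _ _ _ b0 bb hX hC hN.
apply: contraNneq => f0; apply/eqP.
rewrite -(mulr0 ('i / u)) -f0 mulrDr.
have -> : X * Ch = 'i / u * ev u Vp.
  have -> : ev u Vp = r%:C ^+ 2 / 4 / b%:C * (1 - u ^+ 2).
    by rewrite -cC -fmorphV -rmorphM; exact: ev_Vp.
  rewrite /X /Ch -z2.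
  transitivity (r%:C ^+ 2 * (z ^+ 2 - z ^- 2) / (4 * b%:C) * 'i^-1).
    by field; rewrite ?iN ?bCN ?z0 ?u0.
  by rewrite iV; field; rewrite ?iN ?bCN ?z0 ?u0.
by field; rewrite ?iN ?bCN ?z0 ?u0.
Qed.

End Denominator.

(** * Integrands as real parts of rational functions on the circle *)

Section Circle.
Local Open Scope complex_scope.
Variables (R : realType) (a : R) (k l : nat).
Hypothesis a0 : 0 < a.
Local Notation C := R[i].
Local Notation toC := (real_complex R).
Local Notation Re := (@complex.Re R).
Local Notation ev u P := (map_poly toC P).[u].
Local Notation b := (Num.sqrt a).
Local Notation c := ((1 + a) / 4).
Local Notation ss := (SS k.*2.+1 l.*2.+1 a).
Local Notation cc := (CC k.*2.+1 l.*2.+1 a).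
Local Notation wgt := (itv_weight R a).
Local Notation pt t := (circ R (itv_angle R a t)).

Let b0 : 0 < b. Proof. by rewrite sqrtr_gt0. Qed.

Lemma ev_Tp_circ t : - a <= t <= 1 -> ev (pt t) (Tp R a) = pt t * t%:C.
Proof.
move=> ht; rewrite ev_Tp; set al := itv_angle _ _ _; have e := sin2cos2 al.
have -> : t%:C = (itv_point R a al)%:C by rewrite itv_angleK.
rewrite /itv_point; apply/eqP; rewrite /circ !expr2 eq_complex /=.
apply/andP; split; apply/eqP.
  transitivity (cos al + c * ((1 - cos al) ^+ 2 - sin al ^+ 2)); first by field.
  by rewrite e; field.
by field.
Qed.

Lemma ev_Vp_circ t : - a <= t <= 1 -> ev (pt t) (Vp R a) = - 'i * pt t * (wgt t)%:C.
Proof.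
move=> ht; rewrite ev_Vp itv_weight_angle//.
set al := itv_angle _ _ _; have e := sin2cos2 al.
have bN : b != 0 by rewrite gt_eqF.
apply/eqP; rewrite /circ !expr2 eq_complex /=; apply/andP; split; apply/eqP.
  transitivity (c / b * (1 - cos al ^+ 2 + sin al ^+ 2)); first by field.
  transitivity ((1 + a) / 2 / b * sin al ^+ 2); last by field.
  by rewrite e; field.
by field.
Qed.

Lemma ev_Qp_circ t : - a <= t <= 1 ->
  ev (pt t) (Qp R a k l) = - 'i * pt t ^+ (k + l).+1 * (cc t +i* ss t).
Proof.
move=> ht; have [-> -> _] := SS_CC_rho _ k l a t a0 ht.
rewrite (ev_Qp_scaled _ _ _ _ _ _ (ev_Tp_circ t ht)) ev_Vp_circ//.
have [c1 s1] := ch_rmorph _ _ toC k t 1.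
have [c2 s2] := ch_rmorph _ _ toC l (- (t / a)) 1.
rewrite /= rmorphN rmorphM fmorphV rmorph1 /= in c1 s1 c2 s2.
rewrite -c1 -s1 -c2 -s2 exprS.
set x := chc k t 1; set y := chs k t 1; set x' := chc l _ 1; set y' := chs l _ 1.
have -> : (wgt t * (x * x') +i* (t / b * (y * y'))) =
   (wgt t)%:C * (x%:C * x'%:C) + 'i * (t%:C / b%:C * (y%:C * y'%:C)).
  rewrite -fmorphV -!rmorphM /=.
  by apply/eqP; rewrite eq_complex /=; apply/andP; split; apply/eqP; ring.
have ii : 'i * 'i = -1 :> C by rewrite -expr2 sqr_i.
have bCN : b%:C != 0 by rewrite (inj_eq (@complexI _) _ 0) gt_eqF.
set z := pt t.
transitivity (z ^+ (k + l) * (- 'i * z * (wgt t)%:C * (x%:C * x'%:C)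
   - ('i * 'i) * z * (t%:C / b%:C * (y%:C * y'%:C)))); last by ring.
by rewrite ii; field.
Qed.

Lemma circ_neq0 al : circ R al != 0.
Proof. by rewrite -normc_eq0 normc_circ oner_eq0. Qed.

Lemma CC_SS_gt0 t : - a <= t <= 1 -> 0 < cc t ^+ 2 + ss t ^+ 2.
Proof.
move=> ht; have := Qp_nonvanishing R a k l a0 (pt t).
rewrite normc_circ lexx ev_Qp_circ// mulf_eq0 negb_or => /(_ isT)/andP[_].
rewrite eq_complex /= negb_and => h.
rewrite lt_def addr_ge0 ?sqr_ge0// andbT paddr_eq0 ?sqr_ge0//.
by rewrite !sqrf_eq0 negb_and.
Qed.

(** The powers of [u] cancel and leave [i (n1 + i n2) / (CC + i SS)]. Thus a real boundary value
    selects [SS], and an imaginary one selects [CC]. *)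
Lemma Re_ratio_circ (N : {poly R}) (n1 n2 t : R) : - a <= t <= 1 ->
  ev (pt t) N = pt t ^+ (k + l).+1 * (n1 +i* n2) ->
  Re (ev (pt t) N / ev (pt t) (Qp R a k l)) =
  (n1 * ss t - n2 * cc t) / (cc t ^+ 2 + ss t ^+ 2).
Proof.
move=> ht EN; rewrite EN ev_Qp_circ//.
set z := pt t; have z0 : z ^+ (k + l).+1 != 0 by rewrite expf_neq0 ?circ_neq0.
have D0 := CC_SS_gt0 t ht.
set x := cc t in D0 *; set y := ss t in D0 *.
have xy0 : x +i* y != 0.
  rewrite eq_complex /= negb_and -negb_and; apply/negP => /andP[/eqP h1 /eqP h2].
  by move: D0; rewrite h1 h2 expr0n /= addr0 ltxx.
have ii : 'i ^+ 2 = -1 :> C by exact: sqr_i.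
have iN : 'i != 0 :> C by rewrite -sqrf_eq0 ii oppr_eq0 oner_eq0.
have E : z ^+ (k + l).+1 * (n1 +i* n2) / (- 'i * z ^+ (k + l).+1 * (x +i* y)) =
   ((n1 * y - n2 * x) +i* (n1 * x + n2 * y)) * ((x ^+ 2 + y ^+ 2)^-1)%:C.
  have iV : 'i^-1 = - 'i :> C.
    by apply: (mulfI iN); rewrite mulfV// mulrN -expr2 ii opprK.
  transitivity ((n1 +i* n2) * - 'i^-1 / (x +i* y)); first by field; rewrite ?iN ?xy0 ?z0.
  rewrite iV opprK; apply: (mulIf xy0); rewrite divfK//.
  by apply/eqP; rewrite eq_complex /=; apply/andP; split; apply/eqP; field; rewrite gt_eqF.
by rewrite E /= mulr0 subr0.
Qed.

(** Reduces each orthogonality relation to finding a polynomial [N] with the right values on the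
    circle; the integral is then read off at [u = 0]. *)
Lemma integral_ratio (h : R -> R) (N : {poly R}) :
  (forall t, - a < t < 1 -> t != 0 -> exists n1 n2,
     ev (pt t) N = pt t ^+ (k + l).+1 * (n1 +i* n2) /\
     h t = (n1 * ss t - n2 * cc t) / (cc t ^+ 2 + ss t ^+ 2) / wgt t) ->
  (lebesgue_measure : measure _ R).-integrable
    (`[(- a)%R, 1%R]%classic : set R) (fun t => (h t)%:E) /\
  (\int[lebesgue_measure]_(t in `[(- a)%R, 1%R]%classic) (h t)%:E
     = (b * pi * (N.[0] / (Qp R a k l).[0]))%R%:E)%E.
Proof.
move=> hN.
apply: (integral_cos_limit_over_weight _ _ a0
  (fun al => Re (ev (circ R al) N / ev (circ R al) (Qp R a k l)))).
  exact: (Re_ratio_approx_cos _ N _ (Qp_nonvanishing R a k l a0)).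
move=> t ht tN; have [n1 [n2 [EN ->]]] := hN t ht tN.
rewrite (Re_ratio_circ _ _ _ _ _ EN)//.
by move: ht => /andP[/ltW -> /ltW ->].
Qed.

(** Polynomial form of [w ^ 2 = (1 - t) (1 + t / a)]; the sign comes from [w = i Vp u / u]. *)
Lemma Vp_sqr : Vp R a * Vp R a = - (('X - Tp R a) * ('X - Tm R a)).
Proof.
rewrite /Vp /Tm /Tp.
have aN : a != 0 by rewrite gt_eqF.
have e1 : c%:P = a%:P * (c / a)%:P :> {poly R}.
  by rewrite -polyCM; congr _%:P; field.
have e2 : (c / b)%:P * (c / b)%:P = c%:P * (c / a)%:P :> {poly R}.
  rewrite -!polyCM; congr _%:P.
  transitivity (c * c / b ^+ 2); first by field; rewrite gt_eqF.
  by rewrite sqr_sqrtr ?ltW//; field.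
have e3 : 4 * (c / a)%:P = 1 + a^-1%:P :> {poly R}.
  by rewrite -(polyC1 R) -polyCD -(rmorph_nat (@polyC R)) -polyCM; congr _%:P; field.
have e4 : a^-1%:P * c%:P = (c / a)%:P :> {poly R} by rewrite -polyCM; congr _%:P; ring.
transitivity (c%:P * (c / a)%:P * ((1 - 'X ^+ 2) * (1 - 'X ^+ 2)) : {poly R}).
  by rewrite -e2; ring.
transitivity (c%:P * (1 - 'X) ^+ 2 *
   ((1 + a^-1%:P) * 'X + a^-1%:P * c%:P * (1 - 'X) ^+ 2) : {poly R}); last by ring.
by rewrite -e3 e4; ring.
Qed.

(** For [j = -1] the natural numerator ['X^(k + l + 2) / Tp] is not a polynomial. Modulo [Tp],
    [Vp * Qp] is [Vp ^ 2 * 'X^(k + l)], that is [- 'X^(k + l + 2)], so adding it makes the division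
    exact. On the circle the correction adds [Vp / Tp = - i w / t] to the quotient by [Qp], which
    has real part zero. *)
Lemma residue_numerator : exists N : {poly R},
  Tp R a * N = 'X ^+ (k + l).+2 + Vp R a * Qp R a k l.
Proof.
have [r hr] := chc_modx k (Tp R a) 'X; have [r' hr'] := chc_modx l (Tm R a) 'X.
have TmE : Tm R a = - (a^-1%:P * Tp R a) by [].
exists (- ('X ^+ 2 * ('X^k * (- a^-1%:P * r') + r * ('X^l + Tm R a * r'))
   + ('X * a^-1%:P - 'X - a^-1%:P * Tp R a) * (chc k (Tp R a) 'X * chc l (Tm R a) 'X))
   + Vp R a * (b^-1%:P * (chs k (Tp R a) 'X * chs l (Tm R a) 'X))).
rewrite /Qp [Vp R a * (_ + _)]mulrDr [Vp R a * (Vp R a * _)]mulrA Vp_sqr hr hr' TmE.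
rewrite !exprS exprD.
by ring.
Qed.

End Circle.

(** * The orthogonality relations *)

Section Orthogonality.
Variables (R : realType) (a : R) (k l : nat).
Hypothesis a0 : 0 < a.
Local Notation mu := (lebesgue_measure : measure _ R).
Local Notation I := (`[(- a)%R, 1%R]%classic : set R).
Local Notation n := k.*2.+1.
Local Notation m := l.*2.+1.
Local Notation toC := (real_complex R).
Local Notation ev u P := (map_poly toC P).[u].
Local Notation pt t := (circ R (itv_angle R a t)).

Let weight_neq0 t : - a < t < 1 -> itv_weight R a t != 0.
Proof. by move=> ht; rewrite gt_eqF// itv_weight_gt0. Qed.

Let norm_neq0 t : - a < t < 1 -> CC n m a t ^+ 2 + SS n m a t ^+ 2 != 0.
Proof. by move=> /andP[/ltW h1 /ltW h2]; rewrite gt_eqF// CC_SS_gt0// h1 h2. Qed.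

Let rhoE t : - a < t < 1 -> rho n m a t = 2 * (CC n m a t ^+ 2 + SS n m a t ^+ 2).
Proof.
move=> /andP[/ltW h1 /ltW h2].
by have [|_ _ ->] := SS_CC_rho R k l a t a0; rewrite ?h1 ?h2.
Qed.

Let itv_cc t : - a < t < 1 -> - a <= t <= 1.
Proof. by move=> /andP[/ltW -> /ltW ->]. Qed.

Lemma integral_sine_nonneg (j : nat) : (j <= k + l)%N ->
  mu.-integrable I (fun t => (integrand1 n m a j%:Z t)%:E) /\
  (\int[lebesgue_measure]_(t in I) (integrand1 n m a j%:Z t)%:E = 0%R%:E)%E.
Proof.
move=> jkl.
have [t ht t0|J ->] := integral_ratio R a k l a0 (integrand1 n m a j%:Z)
    (* On the circle this is [u ^ (k + l + 1) * t ^ j / 2], the half compensating the factor 2 in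
       [rho]. As [j <= k + l], a positive power of [u] remains and the value at 0 vanishes. *)
    (2^-1%:P * ('X^((k + l).+1 - j) * Tp R a ^+ j)); last first.
  split => //; rewrite !hornerM hornerXn subSn// exprS mul0r mul0r mulr0 mul0r.
  by rewrite mulr0.
exists (t ^+ j / 2), 0; split.
  rewrite !(evM, evXn, evC, evX) ev_Tp_circ ?itv_cc// exprMn.
  have -> : ((t ^+ j / 2) +i* 0)%C = ((2^-1)%:C * t%:C ^+ j)%C.
    by rewrite -rmorphXn -rmorphM mulrC.
  by rewrite -[in RHS](subnK (leqW jkl)) exprD; ring.
rewrite /integrand1 rhoE// mul0r subr0 -exprnP.
have := weight_neq0 t ht; have := norm_neq0 t ht.
rewrite /itv_weight; set w := Num.sqrt _; set D := _ + _ => D0 w0.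
by field; rewrite w0 D0.
Qed.

Lemma integral_sine_inv :
  mu.-integrable I (fun t => (integrand1 n m a (-1) t)%:E) /\
  (\int[lebesgue_measure]_(t in I) (integrand1 n m a (-1) t)%:E = (pi / 2)%R%:E)%E.
Proof.
have [N hN] := residue_numerator R a k l a0.
have b0 : 0 < Num.sqrt a by rewrite sqrtr_gt0.
have bN : Num.sqrt a != 0 by rewrite gt_eqF.
have c0 : (1 + a) / 4 != 0 by rewrite mulf_neq0 ?invr_eq0 ?pnatr_eq0// gt_eqF// addr_gt0.
have [t ht t0|J ->] := integral_ratio R a k l a0 (integrand1 n m a (-1))
    (2^-1%:P * N); last first.
  split => //; congr (_%:E); rewrite hornerM hornerC.
  have := congr1 (horner^~ 0) hN; rewrite /= hornerD hornerXn (hornerM (Tp R a)).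
  rewrite (hornerM (Vp R a)) expr0n add0r Tp0 Vp0 => e.
  have q0 := Qp0_neq0 R a k l a0.
  (* At [u = 0] only the correction term [Vp * Qp] contributes, and [Vp.[0] / Tp.[0] = 1 / sqrt a]
     cancels the factor of the integral. *)
  have -> : N.[0] = (Qp R a k l).[0] / Num.sqrt a.
    by apply: (mulfI c0); rewrite e; field.
  by field; rewrite q0 bN.
set x := CC n m a t; set y := SS n m a t; set w := itv_weight R a t.
(* Real and imaginary parts of [(1 - w (x + i y)) / (2 t)]; in [n1 * y - n2 * x] the terms with [w]
   cancel. *)
exists ((1 - w * x) / (2 * t)), (- (w * y / (2 * t))); split.
  have tC0 : (t%:C != 0)%C by rewrite (inj_eq (@complexI _) _ 0).
  have z0 := circ_neq0 R (itv_angle R a t).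
  have := congr1 (fun P => ev (pt t) P) hN.
  rewrite /= evD (evM _ _ (Tp R a)) (evM _ _ (Vp R a)) evXn evX.
  rewrite ev_Tp_circ ?itv_cc// ev_Vp_circ ?itv_cc//.
  rewrite ev_Qp_circ ?itv_cc// -/x -/y -/w => e; rewrite evM evC.
  have ii : ('i ^+ 2 = -1 :> R[i])%C by exact: sqr_i.
  have -> : (((1 - w * x) / (2 * t)) +i* (- (w * y / (2 * t))))%C =
     (1 - w%:C * (x +i* y))%C / (2 * t%:C)%C.
    apply: (mulIf (mulf_neq0 (_ : 2 != 0) tC0)); first by rewrite pnatr_eq0.
    rewrite divfK ?mulf_neq0 ?pnatr_eq0//.
    have -> : 2 * toC t = toC (2 * t) by rewrite rmorphM rmorph_nat.
    by apply/eqP; rewrite eq_complex /=; apply/andP; split; apply/eqP; field.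
  apply: (mulfI (mulf_neq0 z0 tC0)); rewrite mulrCA e fmorphV rmorph_nat.
  rewrite !exprS.
  transitivity (2^-1 * (pt t * (pt t * pt t ^+ (k + l)) * (1 + 'i ^+ 2 * w%:C * (x +i* y))))%C.
    by ring.
  by rewrite ii; field.
rewrite /integrand1 rhoE// exprN1.
have := weight_neq0 t ht; have := norm_neq0 t ht; rewrite -/x -/y -/w => D0 w0.
have -> : Num.sqrt ((1 - t) * (1 + t / a)) = w by [].
by field; rewrite w0 D0 t0.
Qed.

Lemma integral_cosine (j : nat) : (j < k + l)%N ->
  mu.-integrable I (fun t => (integrand2 n m a j t)%:E) /\
  (\int[lebesgue_measure]_(t in I) (integrand2 n m a j t)%:E = 0%R%:E)%E.
Proof.
move=> jkl.
have [t ht t0|J ->] := integral_ratio R a k l a0 (integrand2 n m a j)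
    (* [Vp = - i u w] makes the boundary value imaginary, which selects [CC], and supplies the [w]
       missing from this integrand. It uses up one power of [u], hence the strict bound
       [j < k + l]. *)
    (2^-1%:P * ('X^(k + l - j) * Tp R a ^+ j * Vp R a)); last first.
  split => //; rewrite !hornerM hornerXn -(subnSK jkl) exprS.
  by rewrite !(mul0r, mulr0).
set x := CC n m a t; set y := SS n m a t; set w := itv_weight R a t.
exists 0, (- (w * t ^+ j / 2)); split.
  rewrite evM (evM _ _ _ (Vp R a)) evM !evXn evC evX.
  rewrite ev_Tp_circ ?itv_cc// ev_Vp_circ ?itv_cc// exprMn -/w.
  have -> : (0 +i* (- (w * t ^+ j / 2)))%C = (- 'i * w%:C * (2^-1)%:C * t%:C ^+ j)%C.
    rewrite -rmorphXn -!mulrA -!rmorphM.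
    by apply/eqP; rewrite eq_complex /=; apply/andP; split; apply/eqP; ring.
  by rewrite -[in RHS](subnK (ltnW jkl)) exprS exprD; ring.
rewrite /integrand2 rhoE//.
have := weight_neq0 t ht; have := norm_neq0 t ht; rewrite -/x -/y -/w => D0 w0.
by field; rewrite w0 D0.
Qed.

End Orthogonality.

Theorem mainTheorem3 (R : realType) (n m : nat) (a : R) :
  odd n -> odd m -> 0 < a ->
  (forall j : int, -1 <= j -> 2 * j + 2 <= (m + n)%:Z ->
     (lebesgue_measure : measure _ R).-integrable (`[(- a)%R, 1%R]%classic : set R)
        (fun t => (integrand1 n m a j t)%:E) /\
     (\int[lebesgue_measure]_(t in (`[(- a)%R, 1%R]%classic : set R)) (integrand1 n m a j t)%:E
        = (if j == -1 then pi / 2 else 0)%:E)%E) /\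
  (forall j : nat, (2 * j + 4 <= m + n)%N ->
     (lebesgue_measure : measure _ R).-integrable (`[(- a)%R, 1%R]%classic : set R)
        (fun t => (integrand2 n m a j t)%:E) /\
     (\int[lebesgue_measure]_(t in (`[(- a)%R, 1%R]%classic : set R)) (integrand2 n m a j t)%:E
        = 0%:E)%E).
Proof.
move=> on om a0; rewrite -(odd_double_half n) -(odd_double_half m) on om.
(* Here [m + n = 2 (k + l + 1)], so the two bounds on [j] become [j <= k + l] and [j < k + l]. *)
move: (n./2) (m./2) => k l; rewrite !add1n; split=> j.
  case: j => [j|[|j]] jge jle.
  - by apply: integral_sine_nonneg => //; lia.
  - exact: integral_sine_inv.
  - by lia.
by move=> jle; apply: integral_cosine => //; lia.
Qed.
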